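(* Let $P_{Y|X}$ be a discrete memoryless channel with finite input alphabet $\mathcal X$ and output alphabet $\mathcal Y$, and let $q:\mathcal X\times\mathcal Y\to\mathbb R$ be a decoding metric. For all finite alphabets $\mathcal X_1,\mathcal X_2$, all distributions $P_{X_1,X_2}$ on $\mathcal X_1\times\mathcal X_2$ and all mappings $\phi:\mathcal X_1\times\mathcal X_2\to\mathcal X$, the mismatch capacity of $P_{Y|X}$ with metric $q$ is at least $\sup\{R_1+R_2:(R_1,R_2)\in\mathcal R_{cog}(P)\}$, where $\mathcal R_{cog}(P)=\mathcal R^{sup}_{cog}(P)\cup\mathcal R^{bin,*}_{cog}(P)$ is computed for the distribution $P=P_{X_1,X_2}P_{Y|X_1,X_2}$ with $P_{Y|X_1,X_2}(y|x_1,x_2)=P_{Y|X}(y|\phi(x_1,x_2))$ and the metric $\tilde q(x_1,x_2,y)=q(\phi(x_1,x_2),y)$.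
   Context: Single-user mismatched decoding: a rate-$R$ code of length $n$ is a set of $2^{nR}$ codewords $\mathbf x(m)\in\mathcal X^n$; messages are uniform; the decoder outputs $m$ iff $\sum_t q(x_t(m),y_t)>\sum_t q(x_t(m'),y_t)$ for all $m'\neq m$, else error. $R$ is achievable if codes exist with average error probability tending to zero; the mismatch capacity is the supremum of achievable rates. For a distribution $Q$ on $\mathcal X_1\times\mathcal X_2\times\mathcal Y$ (with metric $\tilde q$): $\mathcal G(Q)=\{f: f_{X_1,X_2}=Q_{X_1,X_2},\ \mathbb E_f \tilde q(X_1,X_2,Y)\ge\mathbb E_Q\tilde q(X_1,X_2,Y)\}$; $\mathcal L_1(Q)=\{f\in\mathcal G(Q):f_{X_2,Y}=Q_{X_2,Y}\}$; $\mathcal L_2(Q)=\{f\in\mathcal G(Q):f_{X_1,Y}=Q_{X_1,Y}\}$; $\mathcal L_0(Q)=\{f\in\mathcal G(Q):f_Y=Q_Y\}$. $R_1'(P)=\min_{\tilde P\in\mathcal L_1(P)}I_{\tilde P}(X_1;Y,X_2)$; $R_2'(P)=\min_{\tilde P\in\mathcal L_2(P)}I_{\tilde P}(X_2;Y|X_1)$; $R_1''(P,R_2)=\min_{\tilde P\in\mathcal L_0(P)}[I_{\tilde P}(X_1;Y)+|I_{\tilde P}(X_2;Y|X_1)-R_2|^+]$; $R_2''(P,R_1)=\min_{\tilde P\in\mathcal L_0(P)}[I_{\tilde P}(X_2;Y)-I_{\tilde P}(X_2;X_1)+|I_{\tilde P}(X_1;Y,X_2)-R_1|^+]$; $|t|^+=\max\{0,t\}$.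 $\mathcal R^{sup}_{cog}(P)=\{(R_1,R_2):R_2\le R_2'(P),\ R_1\le R_1''(P,R_2)\}$. $\mathcal R^{bin,*}_{cog}(P)$ is the set of $(R_1,R_2)$ for which there exist $R_{1,a},R_{1,b}\ge0$ with $R_1=R_{1,a}+R_{1,b}$, $R_{1,a}\le R_1'(P)$, $R_{1,b}+R_2\le R_2'(P)$, and either $R_{1,a}\le R_1''(P,R_{1,b}+R_2)$ or $R_{1,b}+R_2\le R_2''(P,R_{1,a})$. *)

(* Defs.v *)
From HB Require Import structures.
From mathcomp Require Import all_boot all_order all_algebra.
From mathcomp Require Import all_classical all_reals all_analysis.
Set Implicit Arguments. Unset Strict Implicit. Unset Printing Implicit Defensive.
Import Order.TTheory GRing.Theory Num.Theory.
Import numFieldNormedType.Exports.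
Local Open Scope classical_set_scope.
Local Open Scope ring_scope.

Section InfoTheory.
Variable R : realType.

(** logarithm in base 2 (rates are in bits, codes have 2^{nR} codewords) *)
Definition log2 (x : R) : R := ln x / ln 2.

Definition is_dist (T : finType) (f : T -> R) : Prop :=
  (forall t, 0 <= f t) /\ \sum_(t : T) f t = 1.

Definition pmf_of (T U : finType) (f : T -> R) (g : T -> U) (u : U) : R :=
  \sum_(t : T | g t == u) f t.

Definition entropy (T U : finType) (f : T -> R) (g : T -> U) : R :=
  - \sum_(u : U) (let p := pmf_of f g u in if p == 0 then 0 else p * log2 p).

Definition pairRV (T U V : finType) (g : T -> U) (h : T -> V) : T -> (U * V)%type :=
  fun t => (g t, h t).

Definition mutinf (T U V : finType) (f : T -> R) (A : T -> U) (B : T -> V) : R :=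
  entropy f A + entropy f B - entropy f (pairRV A B).

Definition cmutinf (T U V W : finType) (f : T -> R)
    (A : T -> U) (B : T -> V) (C : T -> W) : R :=
  entropy f (pairRV A C) + entropy f (pairRV B C)
  - entropy f (pairRV (pairRV A B) C) - entropy f C.

Definition expect (T : finType) (f : T -> R) (g : T -> R) : R :=
  \sum_(t : T) f t * g t.

Definition posp (t : R) : R := Num.max 0 t.

Section Cog.
Variables (X1 X2 Y : finType).
Local Notation T := ((X1 * X2) * Y)%type.
Definition rvX1 (t : T) : X1 := t.1.1.
Definition rvX2 (t : T) : X2 := t.1.2.
Definition rvY (t : T) : Y := t.2.
Definition rvX1X2 (t : T) : (X1 * X2)%type := t.1.
Definition rvX2Y (t : T) : (X2 * Y)%type := (t.1.2, t.2).
Definition rvX1Y (t : T) : (X1 * Y)%type := (t.1.1, t.2).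
Definition rvYX2 (t : T) : (Y * X2)%type := (t.2, t.1.2).

Variable qt : X1 -> X2 -> Y -> R.
Definition qtT (t : T) : R := qt t.1.1 t.1.2 t.2.

Definition same_marg (U : finType) (g : T -> U) (f Q : T -> R) : Prop :=
  forall u, pmf_of f g u = pmf_of Q g u.

Definition Gset (Q : T -> R) : set (T -> R) :=
  [set f | is_dist f /\ same_marg rvX1X2 f Q /\ expect Q qtT <= expect f qtT].
Definition L1set (Q : T -> R) : set (T -> R) :=
  [set f | Gset Q f /\ same_marg rvX2Y f Q].
Definition L2set (Q : T -> R) : set (T -> R) :=
  [set f | Gset Q f /\ same_marg rvX1Y f Q].
Definition L0set (Q : T -> R) : set (T -> R) :=
  [set f | Gset Q f /\ same_marg rvY f Q].

Definition R1p (P : T -> R) : R :=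
  inf [set mutinf f rvX1 rvYX2 | f in L1set P].
Definition R2p (P : T -> R) : R :=
  inf [set cmutinf f rvX2 rvY rvX1 | f in L2set P].
Definition R1pp (P : T -> R) (R2 : R) : R :=
  inf [set mutinf f rvX1 rvY + posp (cmutinf f rvX2 rvY rvX1 - R2) | f in L0set P].
Definition R2pp (P : T -> R) (R1 : R) : R :=
  inf [set mutinf f rvX2 rvY - mutinf f rvX2 rvX1
           + posp (mutinf f rvX1 rvYX2 - R1) | f in L0set P].

Definition Rsup_cog (P : T -> R) : set (R * R) :=
  [set r | 0 <= r.1 /\ 0 <= r.2 /\ r.2 <= R2p P /\ r.1 <= R1pp P r.2].

Definition Rbin_cog (P : T -> R) : set (R * R) :=
  [set r | 0 <= r.1 /\ 0 <= r.2 /\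
     exists R1a R1b : R, 0 <= R1a /\ 0 <= R1b /\ r.1 = R1a + R1b /\
       R1a <= R1p P /\ R1b + r.2 <= R2p P /\
       (R1a <= R1pp P (R1b + r.2) \/ R1b + r.2 <= R2pp P R1a)].

Definition R_cog (P : T -> R) : set (R * R) := Rsup_cog P `|` Rbin_cog P.
End Cog.

Section Mismatch.
Variables (X Y : finType) (W : X -> Y -> R) (q : X -> Y -> R).

Definition is_channel : Prop := forall x, is_dist (W x).

Definition chan_n (n : nat) (x : 'I_n -> X) (y : {ffun 'I_n -> Y}) : R :=
  \prod_(t < n) W (x t) (y t).

Definition metric_n (n : nat) (x : 'I_n -> X) (y : {ffun 'I_n -> Y}) : R :=
  \sum_(t < n) q (x t) (y t).

Definition decodes_to (n M : nat) (c : 'I_M -> 'I_n -> X)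
    (y : {ffun 'I_n -> Y}) (m : 'I_M) : bool :=
  [forall m' : 'I_M, (m' != m) ==> (metric_n (c m') y < metric_n (c m) y)].

Definition avg_err (n M : nat) (c : 'I_M -> 'I_n -> X) : R :=
  (M%:R)^-1 * \sum_(m < M) \sum_(y : {ffun 'I_n -> Y} | ~~ decodes_to c y m)
      chan_n (c m) y.

Definition achievable (r : R) : Prop :=
  exists (M : nat -> nat) (c : forall n, 'I_(M n) -> 'I_n -> X),
    (forall n, (2 : R) `^ (n%:R * r) <= (M n)%:R) /\
    (fun n : nat => avg_err (c n)) @ \oo --> (0 : R).

Definition mismatch_capacity : \bar R :=
  ereal_sup [set r%:E | r in achievable].
End Mismatch.

Definition joint_P (X X1 X2 Y : finType) (PX : X1 -> X2 -> R) (W : X -> Y -> R)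
    (phi : X1 -> X2 -> X) : ((X1 * X2) * Y)%type -> R :=
  fun t => PX t.1.1 t.1.2 * W (phi t.1.1 t.1.2) t.2.

Definition induced_metric (X X1 X2 Y : finType) (q : X -> Y -> R)
    (phi : X1 -> X2 -> X) : X1 -> X2 -> Y -> R :=
  fun x1 x2 y => q (phi x1 x2) y.

End InfoTheory.

(* Main.v *)
(** Random superposition coding.  Let one input variable be the cloud variable
    and the other the satellite variable: draw cloud centers i.i.d. from the first
    marginal of P, satellites i.i.d. from the conditional law given their center,
    and discard the codewords of atypical joint type.  A wrong codeword that beats
    a typical transmitted one has with the output a joint type f which nearly
    satisfies the constraints of L_2 (same cloud) or L_0 (other cloud).  Conditional
    type classes have probability at most 2^(-n J(f)), with J continuous in f and
    equal to the relevant mutual information when f has the input marginal of P; by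
    compactness the exponents over nearly feasible f are close to those over L_2
    and L_0.  The factor |I(X_2;Y|X_1) - R_2|^+ is the union bound over the
    satellites of a wrong cloud, truncated at 1.

    For the sum rate the binning region reduces to superposition.  Put
    R_2' = R_{1,b} + R_2.  If R_{1,a} <= R_1''(P, R_2'), then (R_{1,a}, R_2') lies in
    the superposition region.  If R_2' <= R_2''(P, R_{1,a}), exchange the roles of
    X_1 and X_2, with satellite rate max(0, R_{1,a} - I(X_1;X_2)) and the remaining
    rate on the cloud centers. *)
Require Import Defs.
From HB Require Import structures.
From mathcomp Require Import all_boot all_order all_algebra.
From mathcomp Require Import all_classical all_reals all_analysis.
From mathcomp Require Import ring lra.
Import Order.TTheory GRing.Theory Num.Theory.
Import numFieldNormedType.Exports.
Local Open Scope classical_set_scope.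
Local Open Scope ring_scope.
Set Implicit Arguments. Unset Strict Implicit. Unset Printing Implicit Defensive.

(** * Entropy, mutual information and compactness *)

Section Entropy.
Variable R : realType.
Implicit Types T U V W : finType.

Lemma sum_pmf_of T U (f : T -> R) (g : T -> U) (h : U -> R) :
  \sum_t f t * h (g t) = \sum_u pmf_of f g u * h u.
Proof.
rewrite (partition_big g xpredT) //=; apply: eq_bigr => u _.
by rewrite /pmf_of big_distrl /=; apply: eq_bigr => t /eqP ->.
Qed.

Lemma pmf_of_ge0 T U (f : T -> R) (g : T -> U) u :
  (forall t, 0 <= f t) -> 0 <= pmf_of f g u.
Proof. by move=> f0; apply: sumr_ge0. Qed.

Lemma pmf_of_ge T U (f : T -> R) (g : T -> U) t :
  (forall t, 0 <= f t) -> f t <= pmf_of f g (g t).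
Proof.
by move=> f0; rewrite /pmf_of (bigD1 t) //= lerDl; apply: sumr_ge0.
Qed.

Lemma sum_pmf T U (f : T -> R) (g : T -> U) : \sum_u pmf_of f g u = \sum_t f t.
Proof. by rewrite [RHS](partition_big g xpredT). Qed.

Lemma pmf_of_le1 T U (f : T -> R) (g : T -> U) u :
  is_dist f -> pmf_of f g u <= 1.
Proof.
move=> [f0 f1]; rewrite -f1 -(sum_pmf f g) (bigD1 u) //= lerDl.
by apply: sumr_ge0 => v _; exact: pmf_of_ge0.
Qed.

Lemma entropyE T U (f : T -> R) (g : T -> U) :
  entropy f g = - \sum_t f t * log2 (pmf_of f g (g t)).
Proof.
rewrite (sum_pmf_of f g (fun u => log2 (pmf_of f g u))) /entropy; congr (- _).
by apply: eq_bigr => u _ /=; case: eqP => // ->; rewrite mul0r.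
Qed.

(** Entropy depends only on the partition that the variable induces, so tuples can be permuted and
    reassociated freely. *)
Lemma entropy_eqker T U V (f : T -> R) (g : T -> U) (h : T -> V) :
  (forall t t', (g t == g t') = (h t == h t')) -> entropy f g = entropy f h.
Proof.
move=> gh; rewrite !entropyE; congr (- _); apply: eq_bigr => t _.
by congr (_ * log2 _); apply: eq_bigl => t'; rewrite gh.
Qed.

Lemma eq_entropy T U (f f' : T -> R) (g : T -> U) :
  (forall u, pmf_of f g u = pmf_of f' g u) -> entropy f g = entropy f' g.
Proof.
by move=> ff'; rewrite /entropy; congr (- _); apply: eq_bigr => u _; rewrite ff'.
Qed.

Lemma entropy_comp_bij T T' U (f : T -> R) (g : T -> U) (s : T' -> T) :
  bijective s -> entropy (f \o s) (g \o s) = entropy f g.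
Proof.
move=> bs; rewrite !entropyE [in RHS](reindex s) /=; last exact: onW_bij.
congr (- _); apply: eq_bigr => t _; congr (_ * log2 _).
by rewrite /pmf_of [RHS](reindex s) //=; exact: onW_bij.
Qed.

Lemma ln2_gt0 : 0 < ln 2 :> R. Proof. by rewrite ln_gt0 // ltr1n. Qed.

Lemma entropy_ge0 T U (f : T -> R) (g : T -> U) : is_dist f -> 0 <= entropy f g.
Proof.
move=> fd; rewrite /entropy oppr_ge0; apply: sumr_le0 => u _ /=.
case: eqP => // _; apply: mulr_ge0_le0; first by apply: pmf_of_ge0; case: fd.
by rewrite /log2 pmulr_lle0 ?invr_gt0 ?ln2_gt0 // ln_le0 // pmf_of_le1.
Qed.

Lemma le_log2 (x : R) : 0 < x -> log2 x <= (x - 1) / ln 2.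
Proof.
move=> x0; rewrite /log2 ler_pM2r ?invr_gt0 ?ln2_gt0 //.
have := @le_ln1Dx R (x - 1); rewrite (_ : 1 + (x - 1) = x); last by ring.
by apply; rewrite ltrBrDr addNr.
Qed.

Lemma log2M : {in Num.pos &, {morph @log2 R : x y / x * y >-> x + y}}.
Proof. by move=> x y x0 y0; rewrite /log2 lnM // mulrDl. Qed.

Lemma log2V : {in Num.pos, {morph @log2 R : x / x^-1 >-> - x}}.
Proof. by move=> x x0; rewrite /log2 lnV // mulNr. Qed.

(** Gibbs inequality against [h], the law that makes [A] and [B] conditionally independent given
    [C]; it is enough that [h] has mass at most 1. *)
Lemma cmutinf_ge0 T U V W (f : T -> R) (A : T -> U) (B : T -> V) (C : T -> W) :
  is_dist f -> 0 <= cmutinf f A B C.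
Proof.
move=> fd; have f0 := fd.1.
set pAC := pmf_of f (pairRV A C); set pBC := pmf_of f (pairRV B C).
set pABC := pmf_of f (pairRV (pairRV A B) C); set pC := pmf_of f C.
pose h (w : U * V * W) := pAC (w.1.1, w.2) * pBC (w.1.2, w.2) / pC w.2.
have h0 w : 0 <= h w by rewrite /h divr_ge0 ?mulr_ge0 ?pmf_of_ge0.
have sum_h : \sum_w h w <= 1.
  have -> : \sum_w h w = \sum_c \sum_a \sum_b h (a, b, c).
    rewrite pair_big pair_big /= (reindex (fun t => (t.1.2, t.2, t.1.1))) /=.
      by apply: eq_bigr => -[[? ?] ?].
    by apply: onW_bij; exists (fun t => (t.2, t.1.1, t.1.2)) => -[[? ?] ?].
  rewrite -fd.2 -(sum_pmf f C); apply: ler_sum => c _.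
  have mAC : \sum_a pAC (a, c) = pC c.
    rewrite /pC /pmf_of (partition_big A xpredT) //=; apply: eq_bigr => a _.
    by apply: eq_bigl => t; rewrite xpair_eqE andbC.
  have mBC : \sum_a pBC (a, c) = pC c.
    rewrite /pC /pmf_of (partition_big B xpredT) //=; apply: eq_bigr => a _.
    by apply: eq_bigl => t; rewrite xpair_eqE andbC.
  under eq_bigr do rewrite /h /= -mulr_suml -mulr_sumr mBC.
  rewrite -mulr_suml -mulr_suml mAC -/(pC c).
  have [->|pC0] := eqVneq (pC c) 0; first by rewrite !mul0r.
  by rewrite mulfK.
have -> : cmutinf f A B C = - \sum_t f t * (log2 (pAC (A t, C t)) +
   log2 (pBC (B t, C t)) - log2 (pABC (A t, B t, C t)) - log2 (pC (C t))).
  rewrite /cmutinf !entropyE -!sumrN -!big_split /=.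
  by apply: eq_bigr => t _; rewrite /pAC /pBC /pABC /pC /pairRV; ring.
(* Writing 0 as (1 - 1) / ln 2 allows the two 1s to be compared with the masses of [h] and [f]. *)
rewrite oppr_ge0 [leRHS](_ : _ = (1 - 1) / ln 2); last by rewrite subrr mul0r.
apply: (@le_trans _ _ ((\sum_w h w - \sum_t f t) / ln 2)); last first.
  by rewrite fd.2 ler_pM2r ?invr_gt0 ?ln2_gt0 // lerB.
(* Only an inequality: where [pABC] vanishes the left-hand term is 0, while [h] may be positive. *)
have le_h : \sum_t f t * (h (A t, B t, C t) / pABC (A t, B t, C t)) <= \sum_w h w.
  rewrite (sum_pmf_of f (pairRV (pairRV A B) C) (fun w => h w / pABC w)).
  apply: ler_sum => w _; rewrite -/pABC.
  have [->|p0] := eqVneq (pABC w) 0; first by rewrite mul0r.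
  by rewrite mulrCA mulfV // mulr1.
apply: le_trans (_ : ((\sum_t f t * (h (A t, B t, C t) / pABC (A t, B t, C t))
   - \sum_t f t) / ln 2) <= _); last first.
  by rewrite ler_pM2r ?invr_gt0 ?ln2_gt0 // lerD2r.
rewrite -sumrB mulr_suml; apply: ler_sum => t _.
have [ft|ft] := eqVneq (f t) 0; first by rewrite ft !mul0r subrr mul0r.
have {}ft : 0 < f t by rewrite lt_def ft f0.
have q1 : 0 < pAC (A t, C t) by apply: lt_le_trans ft _; exact: (pmf_of_ge (pairRV A C)).
have q2 : 0 < pBC (B t, C t) by apply: lt_le_trans ft _; exact: (pmf_of_ge (pairRV B C)).
have q3 : 0 < pABC (A t, B t, C t).
  by apply: lt_le_trans ft _; exact: (pmf_of_ge (pairRV (pairRV A B) C)).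
have q4 : 0 < pC (C t) by apply: lt_le_trans ft _; exact: (pmf_of_ge C).
have -> : f t * (h (A t, B t, C t) / pABC (A t, B t, C t)) - f t =
   f t * (h (A t, B t, C t) / pABC (A t, B t, C t) - 1) by ring.
rewrite -mulrA ler_pM2l //.
apply: le_trans (le_log2 _); last by rewrite /h /= !divr_gt0 ?mulr_gt0.
rewrite /h /= !log2M ?log2V ?posrE ?mulr_gt0 ?invr_gt0 //.
by rewrite le_eqVlt; apply/orP; left; apply/eqP; ring.
Qed.

(** Condition on a constant: [mutinf] is [cmutinf] plus the entropy of that constant, and both are
    nonnegative. *)
Lemma mutinf_ge0 T U V (f : T -> R) (A : T -> U) (B : T -> V) :
  is_dist f -> 0 <= mutinf f A B.
Proof.
move=> fd; have := cmutinf_ge0 A B (fun=> tt) fd.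
have -> : cmutinf f A B (fun=> tt) = mutinf f A B - entropy f (fun=> tt).
  rewrite /cmutinf /mutinf.
  by congr (_ + _ - _ - _); apply: entropy_eqker => t t';
    rewrite /pairRV !xpair_eqE eqxx andbT.
have := entropy_ge0 (fun _ : T => tt) fd; lra.
Qed.

(** With s the square root of x, this is ln (1/s) < 1/s multiplied out. It controls x ln x near
    0. *)
Lemma xln_bound (x : R) : `|x| < 1 -> `|x * ln x| <= 2 * Num.sqrt `|x|.
Proof.
move=> x1; have [x0|x0] := leP x 0.
  by rewrite ln0 // mulr0 normr0 mulr_ge0 ?sqrtr_ge0.
rewrite gtr0_norm // in x1; rewrite (gtr0_norm x0) ler0_norm; last first.
  by rewrite pmulr_rle0 // ln_le0 // ltW.
set s := Num.sqrt x; have s0 : 0 < s by rewrite sqrtr_gt0.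
have -> : x = s ^+ 2 by rewrite sqr_sqrtr // ltW.
have := ln_sublinear (_ : 0 < s^-1); rewrite invr_gt0 => /(_ s0).
rewrite lnV ?posrE // lnXn // => h.
have -> : - (s ^+ 2 * (ln s *+ 2)) = 2 * (s * (s * - ln s)) by ring.
rewrite ler_pM2l // -[leRHS]mulr1 ler_pM2l // -(mulfV (lt0r_neq0 s0)).
by rewrite ler_pM2l // ltW.
Qed.

Lemma xln_continuous : continuous (fun x : R => x * ln x).
Proof.
move=> x; have [x0|x0|->] := ltgtP x 0.
- apply: cvg_near_cst; near=> y.
  suff y0 : y <= 0 by rewrite (ln0 y0) (ln0 (ltW x0)) !mulr0.
  by near: y; apply: filterS (lt_nbhsl x0) => y /ltW.
- by apply: cvgM; [exact: cvg_id|exact: continuous_ln].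
rewrite /continuous_at mul0r; apply/norm_cvg0P.
apply: (@squeeze_cvgr _ _ _ R (fun=> 0) (fun y => 2 * Num.sqrt `|y|)).
- near=> y; rewrite normr_ge0 /= xln_bound //; near: y.
- exact: cvg_cst.
rewrite -[X in _ --> X](mulr0 2) -[X in 2 * X](@sqrtr0 R) -[X in Num.sqrt X](@normr0 _ R).
apply: cvgM; first exact: cvg_cst.
apply: (@continuous_comp _ _ _ (fun y : R => `|y|)); first exact: norm_continuous.
exact: sqrt_continuous.
Unshelve. all: by end_near. Qed.

(** Continuity for the product topology, stated through arbitrary continuous families so that no
    topology on [T -> R] has to be fixed; [relaxed_constraints] applies it to the identity
    family. *)
Definition coordwise_continuous T (h : (T -> R) -> R) : Prop :=
  forall (S : topologicalType) (F : S -> T -> R),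
    (forall t, continuous (F ^~ t)) -> continuous (fun s => h (F s)).

Lemma pmf_of_continuous T U (g : T -> U) u :
  coordwise_continuous (fun f => pmf_of f g u).
Proof.
move=> S F Fc; apply: (@continuous_big R T +%R 0 (fun t => g t == u)) => // x.
exact: add_continuous.
Qed.

Lemma expect_continuous T (h : T -> R) :
  coordwise_continuous (fun f => expect f h).
Proof.
move=> S F Fc; apply: (@continuous_big R T +%R 0 xpredT).
  by move=> x; exact: add_continuous.
move=> t _ x; apply: cvgM; [exact: Fc|exact: cvg_cst].
Qed.

Lemma entropy_continuous T U (g : T -> U) :
  coordwise_continuous (fun f : T -> R => entropy f g).
Proof.
move=> S F Fc s; rewrite /continuous_at /entropy; apply: cvgN.
apply: (@continuous_big R U +%R 0 xpredT).
  by move=> x; exact: add_continuous.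
move=> u _ x.
(* The convention 0 log 0 = 0 agrees with the value of x ln x at 0, so the case distinction
   disappears. *)
have -> : (fun x => let p := pmf_of (F x) g u in if p == 0 then 0 else p * log2 p)
  = (fun x => (pmf_of (F x) g u * ln (pmf_of (F x) g u)) * (ln 2)^-1).
  apply/funext => z /=; case: eqP => [->|_]; first by rewrite !mul0r.
  by rewrite /log2 mulrA.
apply: cvgM; last exact: cvg_cst.
apply: (@continuous_comp _ _ _ (fun z => pmf_of (F z) g u) (fun p => p * ln p)).
  exact: (pmf_of_continuous Fc).
exact: xln_continuous.
Qed.

(* Whatever holds on the set cut out of a compact box by the closed constraints
   [h i <= 0] still holds, by compactness, for slightly violated constraints. *)
Lemma relaxed_constraints (T : finType) (I : Type) (h : I -> (T -> R) -> R)
    (F : (T -> R) -> R) (c : R) :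
  (forall i, coordwise_continuous (h i)) -> coordwise_continuous F ->
  (forall f, (forall t, 0 <= f t <= 1) -> (forall i, h i f <= 0) -> c < F f) ->
  exists2 eta, 0 < eta &
    forall f, (forall t, 0 <= f t <= 1) -> (forall i, h i f <= eta) -> c < F f.
Proof.
move=> hc' Fc' hF; pose S : topologicalType := prod_topology (fun _ : T => R : topologicalType).
have coordc (t : T) : continuous (fun f : S => f t).
  exact: (@proj_continuous T (fun=> R : topologicalType) t).
have hc i : continuous (h i : S -> R) by exact: (hc' i S (fun f => f)).
have Fc : continuous (F : S -> R) by exact: (Fc' S (fun f => f)).
pose K : set S := [set f | forall t, `[0, 1]%classic (f t)].
have Kc : @compact S K.
  by apply: (tychonoff (fun t : T => @segment_compact R 0 1)).
have /compact_near_coveringP Knc := Kc.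
have := Knc R (0^'+) (fun eta f => (forall i, h i f <= eta) -> c < F f) _.
have /[swap]/[apply] : forall x : S, K x ->
    \forall x' \near x & eta \near 0^'+, (forall i, h i x' <= eta) -> c < F x'.
  (* Near a feasible point [F] exceeds [c] by continuity; near an infeasible one some constraint
     stays above half its value, hence above every small [eta]. *)
  move=> x Kx; have [h0|/existsNP[i /negP]] := pselect (forall i, h i x <= 0).
    have Fx : c < F x by apply: hF => // t; have := Kx t; rewrite /= in_itv.
    near=> x' eta => _ /=; near: x'.
    exact: (@cvgr_gt R S (nbhs x) _ F (F x) (Fc x)).
  rewrite -ltNge => hi; near=> x' eta => /= /(_ i); rewrite leNgt => /negP []//.
  apply: (@lt_trans _ _ (h i x / 2)).
    by near: eta; apply: nbhs_right_lt; rewrite divr_gt0.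
  near: x'; apply: (@cvgr_gt R S (nbhs x) _ (h i) (h i x) (hc i x)).
  by rewrite ltr_pdivrMr // ltr_pMr // ltr1n.
move=> H.
have : \forall eta \near 0^'+, 0 < eta /\ K `<=` (fun f => (forall i, h i f <= eta) -> c < F f).
  near=> eta; split; first by near: eta; exact: nbhs_right_gt.
  by near: eta.
by move=> /filter_ex [eta [eta0 He]]; exists eta.
Unshelve. all: by end_near. Qed.

End Entropy.

(** * Random superposition codebooks *)

Section ProductWeights.
Variables (R : realType) (I S : finType).

Lemma sum_prod_ffun (mu : I -> S -> R) :
  \sum_(F : {ffun I -> S}) \prod_k mu k (F k) = \prod_k \sum_s mu k s.
Proof. by rewrite bigA_distr_bigA. Qed.

Lemma prod_marg1 (mu : S -> R) (g : S -> R) (i : I) : \sum_s mu s = 1 ->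
  \sum_(F : {ffun I -> S}) \prod_k mu (F k) * g (F i) = \sum_s mu s * g s.
Proof.
move=> mu1; pose nu k s := mu s * (if k == i then g s else 1).
rewrite (eq_bigr (fun F : {ffun I -> S} => \prod_k nu k (F k))); last first.
  move=> F _; rewrite big_split /=; congr (_ * _).
  by rewrite -big_mkcond /= big_pred1_eq.
rewrite sum_prod_ffun (bigD1 i) //= [X in _ * X]big1 ?mulr1.
  by rewrite /nu eqxx.
by move=> k /negbTE ki; rewrite /nu ki; under eq_bigr do rewrite mulr1.
Qed.

Lemma prod_marg2 (mu : S -> R) (g : S -> S -> R) (i j : I) :
  \sum_s mu s = 1 -> i != j ->
  \sum_(F : {ffun I -> S}) \prod_k mu (F k) * g (F i) (F j) =
  \sum_s \sum_t mu s * mu t * g s t.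
Proof.
move=> mu1 ij.
(* The indicators pin coordinates [i] and [j] to [a] and [b], so that the integrand factorises over
   the coordinates. *)
pose nu a b k s := mu s * ((if k == i then (s == a)%:R else 1) *
                           (if k == j then (s == b)%:R else 1)).
transitivity (\sum_a \sum_b g a b *
    \sum_(F : {ffun I -> S}) \prod_k nu a b k (F k)).
  under [RHS]eq_bigr => a _ do under eq_bigr => b _ do rewrite mulr_sumr.
  under [RHS]eq_bigr => a _ do rewrite exchange_big /=.
  rewrite [RHS]exchange_big /=; apply: eq_bigr => F _.
  rewrite (bigD1 (F i)) //= (bigD1 (F j)) //= [X in _ + X + _]big1 => [|b bj]; last first.
    by rewrite (bigD1 j) //= /nu eqxx [F j == b]eq_sym (negbTE bj) !(mulr0, mul0r).
  rewrite [X in _ + X]big1 => [|a ai]; last first.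
    apply: big1 => b _.
    by rewrite (bigD1 i) //= /nu eqxx [F i == a]eq_sym (negbTE ai) !(mulr0, mul0r).
  rewrite !addr0 mulrC; congr (_ * _); rewrite /nu; apply: eq_bigr => k _.
  by have [->|_] := eqVneq k i; have [->|_] := eqVneq _ j; rewrite ?eqxx !mulr1.
apply: eq_bigr => a _; apply: eq_bigr => b _; rewrite sum_prod_ffun mulrC.
congr (_ * _); rewrite (bigD1 i) //= (bigD1 j) 1?eq_sym //=.
rewrite [X in _ * (_ * X)]big1 ?mulr1.
  rewrite /nu !eqxx (negbTE ij) eq_sym (negbTE ij); congr (_ * _).
    rewrite (bigD1 a) //= eqxx !mulr1 big1 ?addr0 // => s /negbTE ->.
    by rewrite mul0r mulr0.
  rewrite (bigD1 b) //= eqxx !mulr1 big1 ?addr0 // => s /negbTE ->.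
  by rewrite mulr0 mulr0.
move=> k /andP[/negbTE ki /negbTE kj]; rewrite /nu ki kj.
by under eq_bigr do rewrite !mulr1.
Qed.

End ProductWeights.

Section WeightedAverages.
Variables (R : realType) (S : finType).

(** First-moment step of the probabilistic method: a minimiser of [g] is no worse than the
    average. *)
Lemma exists_le_average (w g : S -> R) (a : R) :
  (forall s, 0 <= w s) -> \sum_s w s = 1 -> \sum_s w s * g s <= a ->
  exists s, g s <= a.
Proof.
move=> w0 w1 le_a; have [s0 _|S0] := pickP S; last first.
  by move/eqP: w1; rewrite big_pred0 // eq_sym oner_eq0.
case: (Order.TotalTheory.arg_minP g (isT : xpredT s0)) => s _ gs.
exists s; apply: le_trans le_a; rewrite -[leLHS]mul1r -w1 mulr_suml.
by apply: ler_sum => t _; rewrite ler_wpM2l // gs.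
Qed.

End WeightedAverages.

Section SuperpositionCoding.
Variables (R : realType) (U V Z : finType) (M1 M2 : nat).
Variables (p1 : U -> R) (p2 : U -> V -> R) (ch : U -> V -> Z -> R).
Variables (met : U -> V -> Z -> R) (good : U -> V -> bool).
Variable typ : U -> V -> Z -> bool.
Hypotheses (p1_ge0 : forall u, 0 <= p1 u) (p1_sum : \sum_u p1 u = 1).
Hypotheses (p2_ge0 : forall u v, 0 <= p2 u v)
  (p2_sum : forall u, \sum_v p2 u v = 1).
Hypotheses (ch_ge0 : forall u v z, 0 <= ch u v z)
  (ch_sum : forall u v, \sum_z ch u v z = 1).

(** Ties count as losses, matching the strict inequality in the decoder. Rivals that are not [good]
    do not compete, as they will be expurgated. *)
Definition beats u v z u' v' := good u' v' && (met u v z <= met u' v' z).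

Local Notation cloud := (U * {ffun 'I_M2 -> V})%type.
Local Notation book := {ffun 'I_M1 -> cloud}.

Definition cloud_center (F : book) (m : 'I_M1 * 'I_M2) : U := (F m.1).1.
Definition satellite (F : book) (m : 'I_M1 * 'I_M2) : V := (F m.1).2 m.2.

Definition failure (F : book) (m : 'I_M1 * 'I_M2) (z : Z) : bool :=
  ~~ good (cloud_center F m) (satellite F m) ||
  [exists m', (m' != m) &&
    beats (cloud_center F m) (satellite F m) z (cloud_center F m') (satellite F m')].

Definition cloud_weight (s : cloud) : R := p1 s.1 * \prod_k p2 s.1 (s.2 k).

Lemma cloud_weight_ge0 s : 0 <= cloud_weight s.
Proof. by rewrite mulr_ge0 // prodr_ge0. Qed.

Lemma sum_cloud (g : cloud -> R) : \sum_s cloud_weight s * g s =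
  \sum_u p1 u * \sum_(vs : {ffun 'I_M2 -> V}) \prod_k p2 u (vs k) * g (u, vs).
Proof.
under [RHS]eq_bigr do rewrite mulr_sumr.
by rewrite pair_big /=; apply: eq_bigr => -[u vs] _; rewrite /cloud_weight mulrA.
Qed.

Lemma sum_cloud_weight : \sum_s cloud_weight s = 1.
Proof.
transitivity (\sum_s cloud_weight s * 1); first by under [RHS]eq_bigr do rewrite mulr1.
rewrite (sum_cloud (fun=> 1)) -[RHS]p1_sum; apply: eq_bigr => u _ /=.
under eq_bigr => vs do rewrite mulr1.
by rewrite (sum_prod_ffun (fun=> p2 u)) big1 ?mulr1.
Qed.

Lemma cloud_marg1 (g : U -> V -> R) (j : 'I_M2) :
  \sum_s cloud_weight s * g s.1 (s.2 j) = \sum_u p1 u * \sum_v p2 u v * g u v.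
Proof.
rewrite (sum_cloud (fun s => g s.1 (s.2 j))); apply: eq_bigr => u _; congr (_ * _).
exact: (prod_marg1 (g u)).
Qed.

Lemma cloud_marg2 (g : U -> V -> V -> R) (j k : 'I_M2) : j != k ->
  \sum_s cloud_weight s * g s.1 (s.2 j) (s.2 k) =
  \sum_u p1 u * \sum_v \sum_v' p2 u v * p2 u v' * g u v v'.
Proof.
move=> jk; rewrite (sum_cloud (fun s => g s.1 (s.2 j) (s.2 k))).
by apply: eq_bigr => u _; congr (_ * _); exact: (prod_marg2 (g u)).
Qed.

(** Given the center, the probability is at most 1 and at most the union bound over the satellites.
    Truncating inside the average over centers is what produces the positive part in the
    exponent. *)
Lemma cloud_exists (e : U -> V -> bool) :
  \sum_s cloud_weight s * [exists k, e s.1 (s.2 k)]%:R <=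
  \sum_u p1 u * Num.min 1 (M2%:R * \sum_(v | e u v) p2 u v).
Proof.
rewrite (sum_cloud (fun s => [exists k, e s.1 (s.2 k)]%:R)); apply: ler_sum => u _ /=.
rewrite ler_wpM2l // le_min; apply/andP; split.
  apply: (@le_trans _ _ (\sum_(vs : {ffun 'I_M2 -> V}) \prod_k p2 u (vs k))).
    apply: ler_sum => vs _; rewrite -[leRHS]mulr1 ler_wpM2l ?prodr_ge0 //.
    by rewrite lern1 leq_b1.
  by rewrite (sum_prod_ffun (fun=> p2 u)) big1.
apply: (@le_trans _ _ (\sum_k \sum_(vs : {ffun 'I_M2 -> V})
    \prod_k p2 u (vs k) * (e u (vs k))%:R)).
  rewrite exchange_big /=; apply: ler_sum => vs _.
  rewrite -mulr_sumr ler_wpM2l ?prodr_ge0 //.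
  case: existsP => [[k ek]|_]; last by rewrite sumr_ge0.
  by rewrite (bigD1 k) //= ek lerDl sumr_ge0.
rewrite (eq_bigr (fun=> \sum_v p2 u v * (e u v)%:R)); last first.
  by move=> k _; exact: (prod_marg1 (fun v => (e u v)%:R)).
rewrite sumr_const card_ord -[leLHS]mulr_natl ler_wpM2l //.
by rewrite [leRHS]big_mkcond; apply: ler_sum => v _; case: (e u v);
  rewrite ?mulr1 ?mulr0.
Qed.

Variables a b d : R.
Hypothesis atypical_le :
  \sum_u p1 u * (\sum_v p2 u v * (\sum_z ch u v z * (~~ typ u v z)%:R)) <= d.
Hypothesis typ_good : forall u v z, typ u v z -> good u v.
Hypotheses (a_ge0 : 0 <= a) (b_ge0 : 0 <= b).
Hypothesis same_cloud_le : forall u v z, typ u v z ->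
  \sum_(v' | beats u v z u v') p2 u v' <= a.
Hypothesis other_cloud_le : forall u v z, typ u v z ->
  \sum_u' p1 u' * Num.min 1 (M2%:R * \sum_(v' | beats u v z u' v') p2 u' v') <= b.

(** The three causes of failure for satellite [j]: an atypical triple, a rival satellite [k] of the
    same cloud, and some satellite of another cloud. *)
Let A1 j (s : cloud) := \sum_z ch s.1 (s.2 j) z * (~~ typ s.1 (s.2 j) z)%:R.
Let A2 j k (s : cloud) := \sum_z ch s.1 (s.2 j) z *
  ((typ s.1 (s.2 j) z)%:R * (beats s.1 (s.2 j) z s.1 (s.2 k))%:R).
Let A3 j (s s' : cloud) := \sum_z ch s.1 (s.2 j) z *
  ((typ s.1 (s.2 j) z)%:R * [exists k, beats s.1 (s.2 j) z s'.1 (s'.2 k)]%:R).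

Lemma failure_le (F : book) (i : 'I_M1) (j : 'I_M2) :
  \sum_z ch (cloud_center F (i, j)) (satellite F (i, j)) z * (failure F (i, j) z)%:R <=
  A1 j (F i) + \sum_(k | k != j) A2 j k (F i) + \sum_(k | k != i) A3 j (F i) (F k).
Proof.
rewrite exchange_big [X in _ + _ + X]exchange_big /= -!big_split /=.
apply: ler_sum => z _; rewrite -!mulr_sumr -!mulrDr ler_wpM2l //.
rewrite /failure /cloud_center /satellite /=.
have [ty|nty] := boolP (typ _ _ z); last first.
  rewrite /= mulr1n; apply: (@le_trans _ _ 1); first by rewrite lern1 leq_b1.
  by rewrite -addrA lerDl addr_ge0 // mulr_ge0 // sumr_ge0.
rewrite (typ_good ty) /= add0r !mul1r.
case: existsP => [[[i' j'] /= /andP[ne bt]]|_]; last first.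
  by rewrite addr_ge0 // sumr_ge0.
have [ii'|ii'] := eqVneq i' i.
  rewrite ii' in ne bt; have jj' : j' != j.
    by apply: contraNneq ne => ->.
  rewrite (bigD1 j') //= bt -addrA lerDl addr_ge0 // sumr_ge0 //.
rewrite [X in _ + X](bigD1 i') //=.
have -> : [exists k, beats (F i).1 ((F i).2 j) z (F i').1 ((F i').2 k)].
  by apply/existsP; exists j'.
by rewrite addrCA lerDl addr_ge0 // sumr_ge0.
Qed.

(** Average the three failure terms over codebooks: the first two involve one cloud, the third two
    independent clouds, so the marginal lemmas reduce them to the bounds [d], [a] and [b]. *)
Lemma superposition_random_coding : exists F : book,
  \sum_m \sum_z ch (cloud_center F m) (satellite F m) z * (failure F m z)%:R <=
  (M1 * M2)%:R * (d + M2.-1%:R * a + M1.-1%:R * b).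
Proof.
have w0 (F : book) : 0 <= \prod_k cloud_weight (F k).
  by apply: prodr_ge0 => k _; exact: cloud_weight_ge0.
apply: (exists_le_average w0).
  by rewrite (sum_prod_ffun (fun=> cloud_weight)) big1 // => k _; exact: sum_cloud_weight.
under eq_bigr do rewrite mulr_sumr.
rewrite exchange_big /=.
have -> : (M1 * M2)%:R = #|{: 'I_M1 * 'I_M2}|%:R :> R by rewrite card_prod !card_ord.
rewrite -sum1_card natr_sum mulr_suml; apply: ler_sum => -[i j] _; rewrite mul1r.
apply: (@le_trans _ _ (\sum_(F : book) \prod_k cloud_weight (F k) *
  (A1 j (F i) + \sum_(k | k != j) A2 j k (F i) + \sum_(k | k != i) A3 j (F i) (F k)))).
  by apply: ler_sum => F _; rewrite ler_wpM2l // failure_le.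
have split_w (F : book) (w : R) :
    w * (A1 j (F i) + \sum_(k | k != j) A2 j k (F i) + \sum_(k | k != i) A3 j (F i) (F k)) =
    w * A1 j (F i) + \sum_(k | k != j) w * A2 j k (F i) + \sum_(k | k != i) w * A3 j (F i) (F k).
  by rewrite !mulrDr; congr (_ + _ + _); exact: mulr_sumr.
under eq_bigr do rewrite split_w.
rewrite !big_split /= (@prod_marg1 R 'I_M1 _ cloud_weight (A1 j) i sum_cloud_weight).
have avg1 (x : U -> V -> R) c : 0 <= c -> (forall u v, x u v <= c) ->
    \sum_u p1 u * \sum_v p2 u v * x u v <= c.
  move=> c0 xc; rewrite -[leRHS]mul1r -p1_sum mulr_suml; apply: ler_sum => u _.
  rewrite ler_wpM2l // -[leRHS]mul1r -(p2_sum u) mulr_suml.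
  by apply: ler_sum => v _; rewrite ler_wpM2l.
have avgch (x : Z -> R) u v c : 0 <= c -> (forall z, x z <= c) ->
    \sum_z ch u v z * x z <= c.
  move=> c0 xc; rewrite -[leRHS]mul1r -(ch_sum u v) mulr_suml.
  by apply: ler_sum => z _; rewrite ler_wpM2l.
apply: lerD; first apply: lerD.
- rewrite (cloud_marg1 (fun u v => \sum_z ch u v z * (~~ typ u v z)%:R)).
  exact: atypical_le.
- rewrite exchange_big /=.
  have -> : M2.-1%:R * a = \sum_(k | k != j) a.
    rewrite sumr_const -[RHS]mulr_natl; congr (_%:R * _).
    by rewrite (eq_card (_ : _ =i predC1 j)) // cardC1 card_ord.
  apply: ler_sum => k kj; rewrite (@prod_marg1 R 'I_M1 _ cloud_weight (A2 j k) i sum_cloud_weight).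
  rewrite (cloud_marg2 (fun u v v' => \sum_z ch u v z *
    ((typ u v z)%:R * (beats u v z u v')%:R))) 1?eq_sym //.
  under eq_bigr do under eq_bigr do under eq_bigr do rewrite -mulrA.
  under eq_bigr do under eq_bigr do rewrite -mulr_sumr.
  apply: avg1 => // u v; under eq_bigr do rewrite mulr_sumr.
  rewrite exchange_big /=; under eq_bigr do under eq_bigr do rewrite mulrCA.
  under eq_bigr do rewrite -mulr_sumr.
  apply: avgch => // z; have [ty|_] := boolP (typ u v z); last first.
    by under eq_bigr do rewrite mul0r mulr0; rewrite big1.
  apply: le_trans (same_cloud_le ty); rewrite [leRHS]big_mkcond.
  by apply: ler_sum => v' _; rewrite mul1r; case: beats; rewrite ?mulr1 ?mulr0.
rewrite exchange_big /=.
have -> : M1.-1%:R * b = \sum_(k | k != i) b.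
  rewrite sumr_const -[RHS]mulr_natl; congr (_%:R * _).
  by rewrite (eq_card (_ : _ =i predC1 i)) // cardC1 card_ord.
apply: ler_sum => k ki.
(* Distinct clouds are independent, so the rival cloud is averaged with the transmitted triple held
   fixed. *)
rewrite (@prod_marg2 R 'I_M1 _ cloud_weight (A3 j) i k sum_cloud_weight) 1?eq_sym //.
under eq_bigr do under eq_bigr do rewrite -mulrA.
under eq_bigr do rewrite -mulr_sumr.
rewrite -[leRHS]mul1r -sum_cloud_weight mulr_suml; apply: ler_sum => s _.
rewrite ler_wpM2l ?cloud_weight_ge0 //; under eq_bigr do rewrite mulr_sumr.
rewrite exchange_big /=; under eq_bigr do under eq_bigr do rewrite mulrCA.
under eq_bigr do rewrite -mulr_sumr.
apply: avgch => // z; have [ty|_] := boolP (typ _ _ z); last first.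
  by under eq_bigr do rewrite mul0r mulr0; rewrite big1.
under eq_bigr do rewrite mul1r.
exact: le_trans (cloud_exists _) (other_cloud_le ty).
Qed.

End SuperpositionCoding.

(** * Expurgation and the passage to achievable rates *)

Section Codes.
Variables (R : realType) (X Y : finType) (W : X -> Y -> R) (q : X -> Y -> R).
Hypothesis channelW : is_channel W.

Lemma chan_n_ge0 n (x : 'I_n -> X) y : 0 <= chan_n W x y.
Proof. by apply: prodr_ge0 => k _; case: (channelW (x k)). Qed.

Lemma sum_chan_n n (x : 'I_n -> X) : \sum_y chan_n W x y = 1.
Proof.
rewrite /chan_n (sum_prod_ffun (fun k => W (x k))) big1 // => k _.
by case: (channelW (x k)).
Qed.

Lemma avg_err_ge0 n M (c : 'I_M -> 'I_n -> X) : 0 <= avg_err W q c.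
Proof.
rewrite mulr_ge0 ?invr_ge0 //; apply: sumr_ge0 => m _.
by apply: sumr_ge0 => y _; exact: chan_n_ge0.
Qed.

(* A codeword outside [G] counts as an error on the left-hand side, so at most
   half of the codewords lie outside [G]. *)
Lemma expurgation n (I : finType) (c : I -> 'I_n -> X) (G : pred I) (e : R) :
  \sum_m \sum_y chan_n W (c m) y *
    (~~ G m || [exists m', (m' != m) &&
      (G m' && (metric_n q (c m) y <= metric_n q (c m') y))])%:R <= #|I|%:R * e ->
  (0 < #|I|)%N -> e <= 2^-1 ->
  exists M (c' : 'I_M -> 'I_n -> X),
    #|I|%:R / 2 <= M%:R :> R /\ avg_err W q c' <= 2 * e.
Proof.
move=> le_e I0 e2; pose err m y := ~~ G m || [exists m', (m' != m) &&
  (G m' && (metric_n q (c m) y <= metric_n q (c m') y))].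
pose E m := \sum_y chan_n W (c m) y * (err m y)%:R.
have E0 m : 0 <= E m by apply: sumr_ge0 => y _; rewrite mulr_ge0 ?chan_n_ge0.
have bad m : ~~ G m -> E m = 1.
  move=> Gm; rewrite /E -[RHS](sum_chan_n (c m)); apply: eq_bigr => y _.
  by rewrite /err Gm mulr1.
have split_E : \sum_(m | G m) E m + \sum_(m | ~~ G m) E m <= #|I|%:R * e.
  by apply: le_trans le_e; rewrite [leRHS](bigID G).
have badE : \sum_(m | ~~ G m) E m = #|I|%:R - #|G|%:R.
  rewrite (eq_bigr (fun=> 1)) // -(cardC G) natrD addrAC subrr add0r.
  by rewrite -sum1_card natr_sum.
have G0 : 0 <= \sum_(m | G m) E m by apply: sumr_ge0.
have cI : 0 < #|I|%:R :> R by rewrite ltr0n.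
have halfG : #|I|%:R / 2 <= #|G|%:R :> R.
  have : #|I|%:R * e <= #|I|%:R / 2 by rewrite ler_wpM2l // ltW.
  by move: split_E; rewrite badE; lra.
have cG : 0 < #|G|%:R :> R by apply: lt_le_trans halfG; rewrite divr_gt0.
exists #|G|, (fun k => c (enum_val k)); split => //.
rewrite /avg_err ler_pdivrMl //.
apply: (@le_trans _ _ (\sum_(m | G m) E m)); last first.
  apply: (@le_trans _ _ (#|I|%:R * e)).
    apply: le_trans split_E; rewrite lerDl; exact: sumr_ge0.
  have e0 : 0 <= e.
    rewrite -(pmulr_rge0 _ cI); apply: le_trans split_E.
    by rewrite addr_ge0 // sumr_ge0.
  by rewrite mulrA ler_wpM2r // -ler_pdivrMr.
rewrite [leRHS](@big_enum_val _ _ _ _ G (fun i => E i)) /=.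
apply: ler_sum => k _; rewrite /E [leLHS]big_mkcond /=; apply: ler_sum => y _.
case: ifPn => [|_]; last by rewrite mulr_ge0 ?chan_n_ge0.
(* A decoding failure of the subcode has a rival in [G], so it was already counted by [err]. *)
rewrite /decodes_to negb_forall => /existsP[k']; rewrite negb_imply -leNgt.
move=> /andP[kk' le_m]; suff -> : err (enum_val k) y by rewrite mulr1.
apply/orP; right; apply/existsP; exists (enum_val k').
by rewrite (inj_eq enum_val_inj) kk' le_m andbT; exact: (enum_valP k').
Qed.

(** The size requirement holds at every [n], the error only in the limit; at exceptional
    blocklengths a large code with all words constant at [x0] will do. *)
Lemma achievable_cvg (r : R) (e : nat -> R) : inhabited X ->
  e @ \oo --> 0 ->
  (\forall n \near \oo, exists M (c : 'I_M -> 'I_n -> X),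
    2 `^ (n%:R * r) <= M%:R /\ avg_err W q c <= e n) ->
  achievable W q r.
Proof.
move=> [x0] e0 He.
pose code n := {M : nat & 'I_M -> 'I_n -> X}.
pose fits n (Mc : code n) := (2 : R) `^ (n%:R * r) <= (projT1 Mc)%:R.
have /= Hcode n : exists Mc : code n, fits n Mc /\
    ((exists M (c : 'I_M -> 'I_n -> X),
      2 `^ (n%:R * r) <= M%:R :> R /\ avg_err W q c <= e n) ->
    avg_err W q (projT2 Mc) <= e n).
  have [[M [c [? ?]]]|nc] := pselect (exists M (c : 'I_M -> 'I_n -> X),
      2 `^ (n%:R * r) <= M%:R :> R /\ avg_err W q c <= e n).
    by exists (existT _ M c).
  exists (existT _ (Num.trunc (2 `^ (n%:R * r) : R)).+1 (fun _ _ => x0)); split => //.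
  by rewrite /fits /= ltW // truncnS_gt.
pose code_of n := projT1 (cid (Hcode n)).
exists (fun n => projT1 (code_of n)), (fun n => projT2 (code_of n)).
have code_ofP n := projT2 (cid (Hcode n)).
split=> [n|]; first by case: (code_ofP n).
apply: (@squeeze_cvgr _ _ _ R (fun=> 0) e) => //; last exact: cvg_cst.
near=> n; rewrite avg_err_ge0 /=; case: (code_ofP n) => _; apply.
by near: n.
Unshelve. all: by end_near. Qed.

End Codes.

(** * Types *)

Section Types.
Variable R : realType.
Implicit Types T U V : finType.

Definition ptype T n (z : 'I_n -> T) (t : T) : R := (\sum_(k < n) (z k == t)%:R) / n%:R.

Definition same_type T n (z z' : 'I_n -> T) : bool :=
  [forall t, ptype z t == ptype z' t].

(** Integer counts give a finite range, of cardinality polynomial in [n], by which sums can be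
    partitioned according to type. *)
Definition type_counts T n (z : 'I_n -> T) : {ffun T -> 'I_n.+1} :=
  [ffun t => inord (\sum_(k < n) (z k == t))].

Lemma type_counts_ptype T n (z z' : 'I_n -> T) :
  type_counts z = type_counts z' -> ptype z =1 ptype z'.
Proof.
have le_n (x : 'I_n -> T) t : (\sum_(k < n) (x k == t) < n.+1)%N.
  rewrite ltnS -[leqRHS](card_ord n) -sum1_card; apply: leq_sum => k _.
  exact: leq_b1.
move=> + t => /ffunP/(_ t); rewrite !ffunE /ptype => /(congr1 val).
by rewrite /= !inordK // -!natr_sum => ->.
Qed.

Lemma sum_ptype T n (z : 'I_n -> T) (h : T -> R) :
  \sum_t ptype z t * h t = (\sum_k h (z k)) / n%:R.
Proof.
under eq_bigr => t _ do rewrite mulrAC mulr_suml.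
rewrite -mulr_suml exchange_big /=; congr (_ / _); apply: eq_bigr => k _.
rewrite (bigD1 (z k)) //= eqxx mul1r big1 ?addr0 // => t.
by rewrite eq_sym => /negbTE ->; rewrite mul0r.
Qed.

Lemma ptype_ge0 T n (z : 'I_n -> T) t : 0 <= ptype z t.
Proof. by rewrite divr_ge0 // sumr_ge0. Qed.

Lemma ptype_gt0 T n (z : 'I_n -> T) k : 0 < ptype z (z k).
Proof.
rewrite divr_gt0 //; last by rewrite ltr0n (leq_ltn_trans _ (ltn_ord k)).
by rewrite (bigD1 k) //= eqxx ltr_pwDl // sumr_ge0.
Qed.

Lemma ptype_dist T n (z : 'I_n -> T) : (0 < n)%N -> is_dist (ptype z).
Proof.
move=> n0; split=> [t|]; first exact: ptype_ge0.
transitivity (\sum_t ptype z t * 1); first by under [RHS]eq_bigr do rewrite mulr1.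
by rewrite sum_ptype sumr_const card_ord divff // pnatr_eq0 -lt0n.
Qed.

Lemma pmf_of_ptype T U n (z : 'I_n -> T) (g : T -> U) u :
  pmf_of (ptype z) g u = ptype (g \o z) u.
Proof.
rewrite /pmf_of big_mkcond /=.
rewrite (eq_bigr (fun t => ptype z t * (g t == u)%:R)); last first.
  by move=> t _; case: eqP; rewrite ?mulr1 ?mulr0.
by rewrite sum_ptype.
Qed.

Lemma expect_ptype T n (z : 'I_n -> T) (h : T -> R) :
  expect (ptype z) h = (\sum_k h (z k)) / n%:R.
Proof. exact: sum_ptype. Qed.

Lemma pow2D (x y : R) : (2 : R) `^ (x + y) = 2 `^ x * 2 `^ y.
Proof. by rewrite powRD // pnatr_eq0 implybT. Qed.

Lemma pow2_log2 (x : R) : 0 < x -> (2 : R) `^ (log2 x) = x.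
Proof.
move=> x0; rewrite /powR /log2 pnatr_eq0 /= mulfVK ?lnK ?posrE //.
by rewrite gt_eqF // ln2_gt0.
Qed.

Lemma pow2_sum (I : finType) (h : I -> R) :
  (2 : R) `^ (\sum_k h k) = \prod_k (2 `^ h k).
Proof.
elim/big_rec2: _ => [|k y x _ <-]; first exact: powRr0.
by rewrite pow2D.
Qed.

Lemma le_pow2 (x y : R) : x <= y -> (2 : R) `^ x <= 2 `^ y.
Proof. by move=> xy; rewrite ler_powR // ler1n. Qed.

(* Compare [p] with the conditional law of [A] given [B] under the type: their
   likelihood ratio is the same for all sequences of the conditional type class. *)
Lemma cond_type_class_le T U V (A : T -> U) (B : T -> V) (p : V -> U -> R)
    n (z : 'I_n -> T) : (forall v u, 0 <= p v u) -> (0 < n)%N ->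
  \sum_(x : {ffun 'I_n -> U} | same_type (fun k => (x k, B (z k))) (pairRV A B \o z))
    \prod_k p (B (z k)) (x k) <=
  2 `^ (n%:R * (entropy (ptype z) (pairRV A B) - entropy (ptype z) B +
                expect (ptype z) (fun t => log2 (p (B t) (A t))))).
Proof.
move=> p0 n0; set E := n%:R * _.
have nR : n%:R != 0 :> R by rewrite pnatr_eq0 -lt0n.
pose fAB := ptype (pairRV A B \o z); pose fB := ptype (B \o z).
(* The logarithm of the ratio of [p] to the empirical conditional law [g] below, for one letter. *)
pose h (w : U * V) := - log2 (fAB w) + log2 (fB w.2) + log2 (p w.2 w.1).
have E1 : E = \sum_k h (pairRV A B (z k)).
  rewrite -[RHS](mulfVK nR) -(sum_ptype z (h \o pairRV A B)) mulrC /E; congr (_ * _).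
  rewrite !entropyE opprK -sumrN /expect -!big_split /=; apply: eq_bigr => t _.
  by rewrite /h !pmf_of_ptype -/fAB -/fB; ring.
pose g v u := fAB (u, v) / fB v.
have g0 v u : 0 <= g v u by rewrite divr_ge0 // ptype_ge0.
apply: (@le_trans _ _ (\sum_(x : {ffun 'I_n -> U})
    2 `^ E * \prod_k g (B (z k)) (x k))); last first.
  rewrite -mulr_sumr (sum_prod_ffun (fun k => g (B (z k)))) -[leRHS]mulr1.
  rewrite ler_wpM2l ?powR_ge0 // prodr_ile1 // => k _; apply/andP; split.
    exact: sumr_ge0.
  rewrite /g -mulr_suml ler_pdivrMr ?mul1r; last exact: (ptype_gt0 (B \o z) k).
  rewrite le_eqVlt; apply/orP; left; apply/eqP.
  rewrite /fB /fAB /ptype -mulr_suml; congr (_ / _); rewrite exchange_big /=.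
  apply: eq_bigr => l _; rewrite (bigD1 (A (z l))) //= xpair_eqE eqxx /=.
  rewrite big1 ?addr0 // => u; rewrite xpair_eqE eq_sym => /negbTE ->; by [].
rewrite big_mkcond; apply: ler_sum => x _; case: ifPn => [sx|_]; last first.
  by rewrite mulr_ge0 ?powR_ge0 ?prodr_ge0.
(* A zero of [p] makes the product vanish; otherwise [log2 p] can be exponentiated back to [p]. *)
have [/existsP[k /eqP pk]|/existsPn np] :=
    boolP [exists k, p (B (z k)) (x k) == 0].
  by rewrite (bigD1 k) //= pk mul0r mulr_ge0 ?powR_ge0 ?prodr_ge0.
have fx w : fAB w = ptype (fun k => (x k, B (z k))) w.
  by have /forallP/(_ w)/eqP := sx.
have -> : E = \sum_k h (x k, B (z k)).
  rewrite E1 -[LHS](mulfVK nR) -[RHS](mulfVK nR); congr (_ * _).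
  rewrite -(sum_ptype (pairRV A B \o z)) -(sum_ptype (fun k => (x k, B (z k)))).
  by apply: eq_bigr => w _; rewrite -fx.
rewrite pow2_sum -big_split /= le_eqVlt; apply/orP; left; apply/eqP.
apply: eq_bigr => k _; rewrite /h /=.
have f1 : 0 < fAB (x k, B (z k)).
  by rewrite fx; exact: (ptype_gt0 (fun k => (x k, B (z k))) k).
have f2 : 0 < fB (B (z k)) by exact: (ptype_gt0 (B \o z) k).
have f3 : 0 < p (B (z k)) (x k) by rewrite lt_def np p0.
rewrite !pow2D -log2V ?posrE // !pow2_log2 ?invr_gt0 // /g.
by field; rewrite !gt_eqF.
Qed.

(** Chebyshev for each letter, then a union bound over letters. The variance of a frequency is at
    most 1/n because the centred indicators [a t] of distinct coordinates are uncorrelated. *)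
Lemma type_deviation T (P : T -> R) n (delta : R) :
  is_dist P -> (0 < n)%N -> 0 < delta ->
  \sum_(z : {ffun 'I_n -> T}) \prod_k P (z k) *
    (~~ [forall t, `|ptype z t - P t| <= delta])%:R <=
  #|T|%:R / (n%:R * delta ^+ 2).
Proof.
move=> [P0 P1] n0 d0.
have nR : 0 < n%:R :> R by rewrite ltr0n.
pose a t s : R := (s == t)%:R - P t.
have Pa t : \sum_s P s * a t s = 0.
  under eq_bigr do rewrite mulrBr.
  rewrite sumrB -mulr_suml P1 mul1r (bigD1 t) //= eqxx mulr1 big1 ?addr0 ?subrr //.
  by move=> s /negbTE ->; rewrite mulr0.
have Pa2 t : \sum_s P s * a t s ^+ 2 <= 1.
  rewrite -P1; apply: ler_sum => s _; rewrite -[leRHS]mulr1 ler_wpM2l //.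
  have Pt1 : P t <= 1 by rewrite -P1 (bigD1 t) //= lerDl sumr_ge0.
  rewrite /a; case: eqP => _; rewrite ?sub0r ?sqrrN exprn_ile1 //.
    by rewrite subr_ge0.
  by rewrite gerBl.
have var t : \sum_(z : {ffun 'I_n -> T}) \prod_k P (z k) * (ptype z t - P t) ^+ 2
    <= n%:R^-1.
  have dev (z : {ffun 'I_n -> T}) :
      (ptype z t - P t) ^+ 2 = n%:R^-2 * \sum_k \sum_l a t (z k) * a t (z l).
    have -> : ptype z t - P t = n%:R^-1 * \sum_k a t (z k).
      rewrite /a sumrB sumr_const card_ord mulrBr -[P t *+ n]mulr_natl mulKf ?gt_eqF //.
      by rewrite /ptype mulrC.
    rewrite exprMn exprVn; congr (_ * _).
    by rewrite expr2 mulr_suml; apply: eq_bigr => k _; rewrite mulr_sumr.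
  under eq_bigr do rewrite dev mulrCA.
  rewrite -mulr_sumr; under eq_bigr do rewrite mulr_sumr.
  rewrite exchange_big /= (_ : n%:R^-1 = n%:R^-2 * n%:R); last first.
    by field; rewrite gt_eqF.
  rewrite ler_wpM2l ?invr_ge0 ?exprn_ge0 //.
  have -> : n%:R = \sum_(k < n) (1 : R) by rewrite sumr_const card_ord.
  apply: ler_sum => k _; under eq_bigr do rewrite mulr_sumr.
  rewrite exchange_big /= (bigD1 k) //= [X in _ + X]big1 ?addr0.
    rewrite (prod_marg1 (fun s => a t s * a t s)) //.
    by under eq_bigr do rewrite -expr2.
  move=> l lk; rewrite (prod_marg2 (fun s s' => a t s * a t s')) 1?eq_sym //.
  rewrite big1 // => s _; under eq_bigr do rewrite mulrACA.
  by rewrite -mulr_sumr Pa mulr0.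
apply: (@le_trans _ _ (\sum_(z : {ffun 'I_n -> T})
    \sum_t (delta ^- 2 * (\prod_k P (z k) * (ptype z t - P t) ^+ 2)))).
  apply: ler_sum => z _.
  have P0z : 0 <= \prod_k P (z k) by exact: prodr_ge0.
  rewrite -mulr_sumr -mulr_sumr mulrCA ler_wpM2l //.
  have S0 : 0 <= delta ^- 2 * \sum_t (ptype z t - P t) ^+ 2.
    by rewrite mulr_ge0 ?invr_ge0 ?sqr_ge0 // sumr_ge0 // => t _; exact: sqr_ge0.
  case: forallP => //= /existsNP[t /negP]; rewrite -ltNge => dt.
  rewrite mulrC ler_pdivlMr ?exprn_gt0 // mul1r (bigD1 t) //=.
  apply: (@le_trans _ _ ((ptype z t - P t) ^+ 2)).
    rewrite -[leRHS]real_normK ?num_real //.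
    by apply: lerXn2r; rewrite ?nnegrE ?normr_ge0 ?(ltW d0) ?(ltW dt).
  by rewrite lerDl sumr_ge0 // => ? _; exact: sqr_ge0.
rewrite exchange_big /= -sum1_card natr_sum mulr_suml; apply: ler_sum => t _.
by rewrite -mulr_sumr mul1r [leRHS]invfM [leRHS]mulrC ler_wpM2l ?invr_ge0 ?sqr_ge0.
Qed.

(** The method of types in abstract form: one bound per class, asked only for classes that contain
    an element [v0] of [E]. *)
Lemma sum_by_key (V K : finType) (key : V -> K) (E : pred V) (w : V -> R) (c : R) :
  (forall v, 0 <= w v) -> 0 <= c ->
  (forall v0, E v0 -> \sum_(v | E v && (key v == key v0)) w v <= c) ->
  \sum_(v | E v) w v <= #|K|%:R * c.
Proof.
move=> w0 c0 H; rewrite (partition_big key xpredT) //= -sum1_card natr_sum mulr_suml.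
apply: ler_sum => x _; rewrite mul1r.
have [v0 Ev0|none] := pickP [pred v | E v && (key v == x)].
  by have /andP[E0 /eqP kx] := Ev0; have := H _ E0; rewrite kx.
by rewrite big_pred0.
Qed.

End Types.

(** * Achievability by superposition *)

(** The term of degree k+1 in the exponential series beats the polynomial with a factor 1/n to
    spare; 2^k comes from n+1 <= 2n. *)
Lemma poly_exp_bound (R : realType) (k : nat) (c : R) : 0 < c ->
  exists C, 0 <= C /\ forall n, (0 < n)%N ->
    n.+1%:R ^+ k * 2 `^ (- (n%:R * c)) <= C / n%:R :> R.
Proof.
move=> c0; pose b := c * ln 2; have b0 : 0 < b by rewrite mulr_gt0 // ln2_gt0.
exists (2 ^+ k * k.+1`!%:R / b ^+ k.+1); split.
  by rewrite divr_ge0 ?mulr_ge0 ?exprn_ge0 // ltW.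
move=> n n0; have nR : 0 < n%:R :> R by rewrite ltr0n.
have nb0 : 0 < n%:R * b by rewrite mulr_gt0.
have -> : (2 : R) `^ (- (n%:R * c)) = (expR (n%:R * b))^-1.
  by rewrite /powR pnatr_eq0 /= -expRN /b; congr expR; ring.
have fact0 : 0 < k.+1`!%:R :> R by rewrite ltr0n fact_gt0.
have le_exp : (expR (n%:R * b))^-1 <= k.+1`!%:R / (n%:R * b) ^+ k.+1.
  rewrite -invf_div lef_pV2 ?posrE ?expR_gt0 ?divr_gt0 ?exprn_gt0 //.
  by apply: le_trans (expR_ge1Dxn k (ltW nb0)); rewrite lerDr.
have le_n : n.+1%:R ^+ k <= (2 * n%:R) ^+ k :> R.
  rewrite lerXn2r ?nnegrE ?mulr_ge0 // -natrM ler_nat mul2n -addnn -addn1.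
  by rewrite leq_add2l.
apply: le_trans (ler_pM _ _ le_n le_exp) _; rewrite ?exprn_ge0 ?invr_ge0 ?expR_ge0 //.
rewrite le_eqVlt; apply/orP; left; apply/eqP.
rewrite !exprMn !exprS; field.
by rewrite !gt_eqF ?exprn_gt0 ?ln2_gt0.
Qed.

(** Lets the truncation at 1 act on each joint type separately. *)
Lemma min1_subadditive (R : realType) (I : Type) (s : seq I) (F : I -> R) :
  (forall i, 0 <= F i) ->
  Num.min 1 (\sum_(i <- s) F i) <= \sum_(i <- s) Num.min 1 (F i).
Proof.
move=> F0; elim: s => [|i s IH]; first by rewrite !big_nil ge_min lexx orbT.
rewrite !big_cons; have S0 : 0 <= \sum_(j <- s) F j by exact: sumr_ge0.
have T0 : 0 <= \sum_(j <- s) Num.min 1 (F j).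
  by apply: sumr_ge0 => j _; rewrite le_min ler01 F0.
have := F0 i; move: IH S0 T0; rewrite !minElt.
by repeat case: ifP; rewrite ?ltNge => *; lra.
Qed.

Section Superposition.
Variables (R : realType) (X Y X1 X2 : finType) (W : X -> Y -> R) (q : X -> Y -> R).
Variables (PX : X1 -> X2 -> R) (phi : X1 -> X2 -> X).
Hypothesis channelW : is_channel W.
Hypothesis distPX : is_dist (fun x : X1 * X2 => PX x.1 x.2).

Local Notation T := ((X1 * X2) * Y)%type.
Local Notation P := (joint_P PX W phi).
Local Notation qt := (induced_metric q phi).

Let PX_ge0 x1 x2 : 0 <= PX x1 x2. Proof. by have := distPX.1 (x1, x2). Qed.

Definition law1 x1 : R := \sum_x2 PX x1 x2.
Definition law2 x2 : R := \sum_x1 PX x1 x2.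
(** The value [law2] at centers of probability 0 is a convention that makes every [kernel21 x1] a
    distribution. *)
Definition kernel21 x1 x2 : R :=
  if law1 x1 == 0 then law2 x2 else PX x1 x2 / law1 x1.

Lemma law1_ge0 x1 : 0 <= law1 x1. Proof. by apply: sumr_ge0. Qed.

Lemma sum_law1 : \sum_x1 law1 x1 = 1.
Proof. by rewrite -distPX.2 /law1 pair_big. Qed.

Lemma kernel21_ge0 x1 x2 : 0 <= kernel21 x1 x2.
Proof.
rewrite /kernel21; case: ifP => _; first by apply: sumr_ge0.
by rewrite divr_ge0 // law1_ge0.
Qed.

Lemma sum_kernel21 x1 : \sum_x2 kernel21 x1 x2 = 1.
Proof.
rewrite /kernel21; case: eqP => [_|/eqP p0].
  by rewrite -sum_law1 /law2 exchange_big.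
by rewrite -mulr_suml divff.
Qed.

Lemma law1_kernel21 x1 x2 : law1 x1 * kernel21 x1 x2 = PX x1 x2.
Proof.
rewrite /kernel21; case: eqP => [p0|/eqP p0]; last by rewrite mulrC divfK.
rewrite p0 mul0r; apply/esym/eqP; rewrite eq_le PX_ge0 andbT -p0.
by rewrite /law1 (bigD1 x2) //= lerDl sumr_ge0.
Qed.

Lemma joint_P_dist : is_dist P.
Proof.
split=> [t|]; first by rewrite mulr_ge0 //; case: (channelW (phi t.1.1 t.1.2)).
rewrite -distPX.2; transitivity (\sum_x \sum_y P (x, y)).
  by rewrite pair_big /=; apply: eq_bigr => -[].
apply: eq_bigr => x _; rewrite /joint_P /= -mulr_sumr.
by rewrite (channelW _).2 mulr1.
Qed.

Lemma pmf_joint_P x : pmf_of P (@rvX1X2 X1 X2 Y) x = PX x.1 x.2.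
Proof.
rewrite /pmf_of (eq_bigl (fun t : T => (t.1 == x) && true)); last first.
  by move=> t; rewrite andbT.
rewrite -(pair_big_dep (fun a : X1 * X2 => a == x) (fun _ _ => true)
  (fun a y => P (a, y))) /= big_pred1_eq.
by rewrite /joint_P /= -mulr_sumr (channelW _).2 mulr1.
Qed.

Section MarginalPX.
Variable f : T -> R.
Hypotheses (f_dist : is_dist f) (f_PX : same_marg (@rvX1X2 X1 X2 Y) f P).

Lemma pmf_rvX1 x1 : pmf_of f (@rvX1 X1 X2 Y) x1 = law1 x1.
Proof.
rewrite /pmf_of (partition_big (@rvX2 X1 X2 Y) xpredT) //=.
apply: eq_bigr => x2 _; rewrite -(pmf_joint_P (x1, x2)) -f_PX /pmf_of.
by apply: eq_bigl => -[[a b] y].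
Qed.

Lemma expect_log_law1 :
  expect f (fun t => log2 (law1 t.1.1)) = - entropy f (@rvX1 X1 X2 Y).
Proof.
by rewrite entropyE opprK; apply: eq_bigr => t _; rewrite pmf_rvX1.
Qed.

Lemma expect_log_kernel21 :
  expect f (fun t => log2 (kernel21 t.1.1 t.1.2)) =
  entropy f (@rvX1 X1 X2 Y) - entropy f (@rvX1X2 X1 X2 Y).
Proof.
rewrite !entropyE opprK -sumrN -big_split /=; apply: eq_bigr => t _.
(* Letters of mass 0 contribute nothing; on the support of [f] both [PX] and [law1] are positive and
   the logarithm of the quotient splits. *)
have [->|ft] := eqVneq (f t) 0; first by rewrite !mul0r oppr0 addr0.
have {}ft : 0 < f t by rewrite lt_def ft f_dist.1.
have PXt : 0 < PX t.1.1 t.1.2.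
  rewrite -(pmf_joint_P t.1) -f_PX; apply: lt_le_trans ft _.
  exact: (pmf_of_ge (@rvX1X2 X1 X2 Y) t f_dist.1).
have l1 : 0 < law1 t.1.1.
  by rewrite lt_def law1_ge0 andbT; apply: contraTneq PXt => p0;
     rewrite -law1_kernel21 p0 mul0r ltxx.
rewrite pmf_rvX1 f_PX pmf_joint_P /kernel21 gt_eqF // log2M ?log2V ?posrE ?invr_gt0 //.
by rewrite /rvX1X2 /rvX1; ring.
Qed.
End MarginalPX.

(** The exponent that [cond_type_class_le] gives for random centers, as [exponent2] does for
    satellites. Both make sense for types whose input marginal is only close to [PX], and since
    [log2 0] is 0 the expectation is a finite linear function of [f]. *)
Definition exponent1 (f : T -> R) : R :=
  entropy f (@rvY X1 X2 Y) - entropy f (pairRV (@rvX1 X1 X2 Y) (@rvY X1 X2 Y))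
  - expect f (fun t => log2 (law1 t.1.1)).

Definition exponent2 (f : T -> R) : R :=
  entropy f (@rvX1Y X1 X2 Y) - entropy f (pairRV (@rvX2 X1 X2 Y) (@rvX1Y X1 X2 Y))
  - expect f (fun t => log2 (kernel21 t.1.1 t.1.2)).

Lemma exponent1E f : is_dist f -> same_marg (@rvX1X2 X1 X2 Y) f P ->
  exponent1 f = mutinf f (@rvX1 X1 X2 Y) (@rvY X1 X2 Y).
Proof. by move=> fd fP; rewrite /exponent1 expect_log_law1 // /mutinf; ring. Qed.

Lemma exponent2E f : is_dist f -> same_marg (@rvX1X2 X1 X2 Y) f P ->
  exponent2 f = cmutinf f (@rvX2 X1 X2 Y) (@rvY X1 X2 Y) (@rvX1 X1 X2 Y).
Proof.
move=> fd fP; rewrite /exponent2 expect_log_kernel21 // /cmutinf.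
have -> : entropy f (@rvX1Y X1 X2 Y) =
    entropy f (pairRV (@rvY X1 X2 Y) (@rvX1 X1 X2 Y)).
  by apply: entropy_eqker => t t'; rewrite !xpair_eqE andbC.
have -> : entropy f (@rvX1X2 X1 X2 Y) =
    entropy f (pairRV (@rvX2 X1 X2 Y) (@rvX1 X1 X2 Y)).
  apply: entropy_eqker => -[[a b] y] [[a' b'] y'].
  by rewrite /rvX1X2 /pairRV !xpair_eqE andbC.
have -> : entropy f (pairRV (@rvX2 X1 X2 Y) (@rvX1Y X1 X2 Y)) =
    entropy f (pairRV (pairRV (@rvX2 X1 X2 Y) (@rvY X1 X2 Y)) (@rvX1 X1 X2 Y)).
  apply: entropy_eqker => t t'.
  by rewrite !xpair_eqE -andbA; congr (_ && _); rewrite andbC.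
ring.
Qed.

(** The constraints of [L2set] ([g] is [rvX1Y]) or [L0set] ([g] is [rvY]) in the one-sided form used
    by [relaxed_constraints]. *)
Definition defect (U : finType) (g : T -> U) (i : (X1 * X2) + U + unit)
    (f : T -> R) : R :=
  match i with
  | inl (inl x) => `|pmf_of f (@rvX1X2 X1 X2 Y) x - pmf_of P (@rvX1X2 X1 X2 Y) x|
  | inl (inr u) => `|pmf_of f g u - pmf_of P g u|
  | inr _ => expect P (qtT qt) - expect f (qtT qt)
  end.

Lemma defect_le0 (U : finType) (g : T -> U) f :
  (forall t, 0 <= f t <= 1) -> (forall i, defect g i f <= 0) ->
  Gset qt P f /\ same_marg g f P.
Proof.
move=> f01 d0.
have fP : same_marg (@rvX1X2 X1 X2 Y) f P.
  by move=> x; have := d0 (inl (inl x)); rewrite /= normr_le0 subr_eq0 => /eqP.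
split; last first.
  by move=> u; have := d0 (inl (inr u)); rewrite /= normr_le0 subr_eq0 => /eqP.
split; last by split => //; have := d0 (inr tt); rewrite /= subr_le0.
split=> [t|]; first by case/andP: (f01 t).
(* Total mass 1 is inherited from [P] through the input marginal. *)
rewrite -(sum_pmf f (@rvX1X2 X1 X2 Y)) (eq_bigr _ (fun x _ => fP x)) sum_pmf.
exact: joint_P_dist.2.
Qed.

Lemma defect_continuous (U : finType) (g : T -> U) i :
  coordwise_continuous (defect g i).
Proof.
move=> S F Fc s; case: i => [[x|u]|b]; rewrite /continuous_at /=.
- apply: cvg_norm; apply: cvgB; last exact: cvg_cst.
  exact: (pmf_of_continuous Fc).
- apply: cvg_norm; apply: cvgB; last exact: cvg_cst.
  exact: (pmf_of_continuous Fc).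
- apply: cvgB; first exact: cvg_cst.
  exact: (expect_continuous Fc).
Qed.

Lemma exponent1_continuous : coordwise_continuous exponent1.
Proof.
move=> S F Fc s; apply: cvgB; [apply: cvgB|];
  [exact: (entropy_continuous Fc)|exact: (entropy_continuous Fc)|
   exact: (expect_continuous Fc)].
Qed.

Lemma exponent2_continuous : coordwise_continuous exponent2.
Proof.
move=> S F Fc s; apply: cvgB; [apply: cvgB|];
  [exact: (entropy_continuous Fc)|exact: (entropy_continuous Fc)|
   exact: (expect_continuous Fc)].
Qed.

Lemma same_cloud_exponent (R2 c : R) :
  (forall f, L2set qt P f -> R2 <= cmutinf f (@rvX2 X1 X2 Y) (@rvY X1 X2 Y) (@rvX1 X1 X2 Y)) ->
  c < R2 -> exists2 eta, 0 < eta & forall f, (forall t, 0 <= f t <= 1) ->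
    (forall i, defect (@rvX1Y X1 X2 Y) i f <= eta) -> c < exponent2 f.
Proof.
move=> H cR; apply: relaxed_constraints; [exact: defect_continuous|exact: exponent2_continuous|].
move=> f f01 /(defect_le0 f01) [fG fg]; rewrite exponent2E; [|exact: fG.1|exact: fG.2.1].
by apply: lt_le_trans cR _; apply: H; split.
Qed.

Lemma other_cloud_exponent (R1 R2 c : R) :
  (forall f, L0set qt P f -> R1 <= mutinf f (@rvX1 X1 X2 Y) (@rvY X1 X2 Y) +
     posp (cmutinf f (@rvX2 X1 X2 Y) (@rvY X1 X2 Y) (@rvX1 X1 X2 Y) - R2)) ->
  c < R1 -> exists2 eta, 0 < eta & forall f, (forall t, 0 <= f t <= 1) ->
    (forall i, defect (@rvY X1 X2 Y) i f <= eta) ->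
    c < exponent1 f + posp (exponent2 f - R2).
Proof.
move=> H cR; apply: relaxed_constraints; first exact: defect_continuous.
  move=> S F Fc s; apply: cvgD; first exact: (exponent1_continuous Fc).
  apply: (@continuous_max R S (fun=> 0) (fun s => exponent2 (F s) - R2) s).
    exact: cvg_cst.
  by apply: cvgB; [exact: (exponent2_continuous Fc)|exact: cvg_cst].
move=> f f01 /(defect_le0 f01) [fG fg].
rewrite exponent1E ?exponent2E; [|exact: fG.1|exact: fG.2.1|exact: fG.1|exact: fG.2.1].
by apply: lt_le_trans cR _; apply: H; split.
Qed.

(** * Type-class bounds and codes at a fixed blocklength *)

Section Blocklength.
Variable n : nat.
Hypothesis n_gt0 : (0 < n)%N.

Local Notation U := {ffun 'I_n -> X1}.
Local Notation V := {ffun 'I_n -> X2}.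
Local Notation Z := {ffun 'I_n -> Y}.
Local Notation types := {ffun T -> 'I_n.+1}.

Definition zip3 (u : U) (v : V) (z : Z) (k : 'I_n) : T := ((u k, v k), z k).
Definition word (u : U) (v : V) (k : 'I_n) : X := phi (u k) (v k).
Definition weight1 (u : U) : R := \prod_k law1 (u k).
Definition weight2 (u : U) (v : V) : R := \prod_k kernel21 (u k) (v k).
Definition block_channel (u : U) (v : V) (z : Z) : R := chan_n W (word u v) z.
Definition block_metric (u : U) (v : V) (z : Z) : R := metric_n q (word u v) z.
Definition good_pair (eta : R) (u : U) (v : V) : bool :=
  [forall x : X1 * X2, `|ptype R (fun k => (u k, v k)) x - PX x.1 x.2| <= eta].
Definition typical (delta : R) (u : U) (v : V) (z : Z) : bool :=
  [forall t, `|ptype R (zip3 u v z) t - P t| <= delta].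

Lemma weight1_ge0 u : 0 <= weight1 u.
Proof. by apply: prodr_ge0 => k _; exact: law1_ge0. Qed.

Lemma weight2_ge0 u v : 0 <= weight2 u v.
Proof. by apply: prodr_ge0 => k _; exact: kernel21_ge0. Qed.

Lemma sum_weight1 : \sum_u weight1 u = 1.
Proof.
rewrite /weight1 (sum_prod_ffun (fun=> law1)) big1 // => k _; exact: sum_law1.
Qed.

Lemma sum_weight2 u : \sum_v weight2 u v = 1.
Proof.
rewrite /weight2 (sum_prod_ffun (fun k => kernel21 (u k))) big1 // => k _.
exact: sum_kernel21.
Qed.

Lemma pmf_close (delta : R) (f : T -> R) (K : finType) (g : T -> K) w :
  (forall t, `|f t - P t| <= delta) ->
  `|pmf_of f g w - pmf_of P g w| <= #|{: T}|%:R * delta.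
Proof.
move=> H; rewrite /pmf_of -sumrB; apply: le_trans (ler_norm_sum _ _ _) _.
rewrite big_mkcond -sum1_card natr_sum mulr_suml; apply: ler_sum => t _.
by rewrite mul1r; case: ifP => _; rewrite ?H // (le_trans _ (H t)).
Qed.

Lemma typical_good delta eta u v z : #|{: T}|%:R * delta <= eta ->
  typical delta u v z -> good_pair eta u v.
Proof.
move=> de /forallP ty; apply/forallP => x; apply: le_trans de.
by have := pmf_close (@rvX1X2 X1 X2 Y) x ty; rewrite pmf_of_ptype pmf_joint_P.
Qed.

(** The input marginal is close because the rival is good, the [g]-marginal because it is shared
    with a typical triple, and the metric because the rival scores at least as much as that
    triple. *)
Lemma defect_beats delta eta (K : finType) (g : T -> K) u v z u' v' i :
  #|{: T}|%:R * delta <= eta -> delta * \sum_t `|qtT qt t| <= eta ->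
  typical delta u v z -> beats block_metric (good_pair eta) u v z u' v' ->
  g \o zip3 u' v' z =1 g \o zip3 u v z ->
  defect g i (ptype R (zip3 u' v' z)) <= eta.
Proof.
move=> de1 de2 /forallP ty /andP[/forallP gd le_met] gz.
case: i => [[x|w]|b] /=.
- by rewrite pmf_of_ptype pmf_joint_P; exact: gd.
- rewrite pmf_of_ptype (funext gz) -pmf_of_ptype.
  by apply: le_trans de1; exact: pmf_close.
have met_expect a c : expect (ptype R (zip3 a c z)) (qtT qt) = block_metric a c z / n%:R.
  by rewrite expect_ptype.
have : expect (ptype R (zip3 u v z)) (qtT qt) <= expect (ptype R (zip3 u' v' z)) (qtT qt).
  by rewrite !met_expect ler_pM2r // invr_gt0 ltr0n.
have : expect P (qtT qt) - expect (ptype R (zip3 u v z)) (qtT qt) <= eta.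
  apply: le_trans de2; rewrite /expect -sumrB mulr_sumr; apply: ler_sum => t _.
  rewrite -mulrBl; apply: le_trans (ler_norm _) _; rewrite normrM.
  by rewrite ler_wpM2r // distrC.
lra.
Qed.

(** Center, satellite and output together form a word of independent letters with law [P], so
    [type_deviation] applies. *)
Lemma atypical_weight delta : 0 < delta ->
  \sum_u weight1 u * (\sum_v weight2 u v *
    (\sum_z block_channel u v z * (~~ typical delta u v z)%:R)) <=
  #|{: T}|%:R / (n%:R * delta ^+ 2).
Proof.
move=> d0; apply: le_trans (type_deviation joint_P_dist n_gt0 d0).
under eq_bigr do rewrite mulr_sumr.
rewrite pair_big /=; under eq_bigr do rewrite mulr_sumr mulr_sumr.
rewrite pair_big /= le_eqVlt; apply/orP; left; apply/eqP.
rewrite [RHS](reindex (fun t : U * V * Z => finfun (zip3 t.1.1 t.1.2 t.2))) /=; last first.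
  apply: onW_bij.
  exists (fun w : {ffun 'I_n -> T} =>
    ([ffun k => (w k).1.1], [ffun k => (w k).1.2], [ffun k => (w k).2])).
    move=> [[u v] z] /=; congr (_, _, _); apply/ffunP => k; by rewrite !ffunE.
  by move=> w; apply/ffunP => k; rewrite !ffunE /zip3 !ffunE; case: (w k) => [[]].
apply: eq_bigr => -[[u v] z] _ /=.
rewrite (_ : [forall t, _] = typical delta u v z); last first.
  apply: eq_forallb => t; congr (`|ptype R _ t - _| <= _).
  by apply/funext => k; rewrite ffunE.
rewrite !mulrA; congr (_ * _).
rewrite /weight1 /weight2 /block_channel /chan_n -!big_split /=.
by apply: eq_bigr => k _; rewrite ffunE law1_kernel21.
Qed.

Lemma satellite_class u v0 z :
  \sum_(v | type_counts (zip3 u v z) == type_counts (zip3 u v0 z)) weight2 u v <=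
  2 `^ (- (n%:R * exponent2 (ptype R (zip3 u v0 z)))).
Proof.
have := cond_type_class_le (@rvX2 X1 X2 Y) (@rvX1Y X1 X2 Y)
  (p := fun b x2 => kernel21 b.1 x2) (zip3 u v0 z) (fun b x2 => kernel21_ge0 b.1 x2) n_gt0.
rewrite (_ : - (n%:R * _) = n%:R * (entropy (ptype R (zip3 u v0 z))
  (pairRV (@rvX2 X1 X2 Y) (@rvX1Y X1 X2 Y)) - entropy (ptype R (zip3 u v0 z))
  (@rvX1Y X1 X2 Y) + expect (ptype R (zip3 u v0 z))
  (fun t => log2 (kernel21 t.1.1 t.1.2)))); last by rewrite /exponent2; ring.
apply: le_trans; rewrite big_mkcond [leRHS]big_mkcond; apply: ler_sum => v _.
case: ifP => [/eqP E|_]; last first.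
  by case: ifP => // _; apply: prodr_ge0 => k _; exact: kernel21_ge0.
suff -> : same_type R (fun k => (v k, rvX1Y (zip3 u v0 z k)))
  (pairRV (@rvX2 X1 X2 Y) (@rvX1Y X1 X2 Y) \o zip3 u v0 z) by [].
apply/forallP => w; rewrite -pmf_of_ptype; apply/eqP.
rewrite (_ : (fun k => _) = pairRV (@rvX2 X1 X2 Y) (@rvX1Y X1 X2 Y) \o zip3 u v z) //.
by rewrite -pmf_of_ptype; apply: eq_bigr => t _; exact: type_counts_ptype.
Qed.

(** [exponent1] sees the joint type only through its marginal on (X1,Y), so the bound is the same
    for every completion [v0]. *)
Lemma center_class (u0 : U) (v0 : V) (z : Z) :
  \sum_(u : U | same_type R (fun k => (u k, z k)) (fun k => (u0 k, z k))) weight1 u <=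
  2 `^ (- (n%:R * exponent1 (ptype R (zip3 u0 v0 z)))).
Proof.
have := cond_type_class_le (@rvX1 X1 X2 Y) (@rvY X1 X2 Y)
  (p := fun _ x1 => law1 x1) (zip3 u0 v0 z) (fun _ x1 => law1_ge0 x1) n_gt0.
rewrite (_ : - (n%:R * _) = n%:R * (entropy (ptype R (zip3 u0 v0 z))
  (pairRV (@rvX1 X1 X2 Y) (@rvY X1 X2 Y)) - entropy (ptype R (zip3 u0 v0 z))
  (@rvY X1 X2 Y) + expect (ptype R (zip3 u0 v0 z))
  (fun t => log2 (law1 t.1.1)))); last by rewrite /exponent1; ring.
by [].
Qed.

(** A rival in the same cloud shares center and output with the transmitted triple, hence the
    marginal on (X1,Y). *)
Lemma same_cloud_bound (delta eta c : R) u v z :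
  #|{: T}|%:R * delta <= eta -> delta * \sum_t `|qtT qt t| <= eta ->
  (forall f, (forall t, 0 <= f t <= 1) ->
    (forall i, defect (@rvX1Y X1 X2 Y) i f <= eta) -> c < exponent2 f) ->
  typical delta u v z ->
  \sum_(v' | beats block_metric (good_pair eta) u v z u v') weight2 u v' <=
  #|{: types}|%:R * 2 `^ (- (n%:R * c)).
Proof.
move=> de1 de2 Hc ty; apply: (sum_by_key (key := fun v' => type_counts (zip3 u v' z))).
- by move=> v'; exact: weight2_ge0.
- exact: powR_ge0.
move=> v0 bt; apply: (@le_trans _ _ (2 `^ (- (n%:R * exponent2 (ptype R (zip3 u v0 z)))))).
  apply: le_trans (satellite_class u v0 z); rewrite big_mkcond [leRHS]big_mkcond.
  apply: ler_sum => v' _; case: ifP => [/andP[_ ->]//|_].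
  by case: ifP => // _; exact: weight2_ge0.
apply: le_pow2; rewrite lerN2 ler_wpM2l // ltW // Hc // => [t|i].
  rewrite ptype_ge0 /=; have [f0 <-] := ptype_dist R (zip3 u v0 z) n_gt0.
  by rewrite (bigD1 t) //= lerDl sumr_ge0.
by apply: (defect_beats i de1 de2 ty bt).
Qed.

(** For each joint type, the compatible rival centers lie in one conditional type class, which costs
    [exponent1]; the truncated union bound over their satellites costs the positive part of
    [exponent2 - R2]. *)
Lemma other_cloud_bound (delta eta c R2 : R) (M2 : nat) u v z :
  #|{: T}|%:R * delta <= eta -> delta * \sum_t `|qtT qt t| <= eta ->
  (forall f, (forall t, 0 <= f t <= 1) ->
    (forall i, defect (@rvY X1 X2 Y) i f <= eta) ->
    c < exponent1 f + posp (exponent2 f - R2)) ->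
  M2%:R <= 2 * 2 `^ (n%:R * R2) ->
  typical delta u v z ->
  \sum_u' weight1 u' * Num.min 1 (M2%:R *
    \sum_(v' | beats block_metric (good_pair eta) u v z u' v') weight2 u' v') <=
  #|{: types}|%:R * (2 * 2 `^ (- (n%:R * c))).
Proof.
move=> de1 de2 Hc M2R ty.
pose key u' v' := type_counts (zip3 u' v' z).
pose E u' v' := beats block_metric (good_pair eta) u v z u' v'.
pose mass (N : types) u' := \sum_(v' | E u' v' && (key u' v' == N)) weight2 u' v'.
have mass_ge0 N u' : 0 <= mass N u' by apply: sumr_ge0 => *; exact: weight2_ge0.
apply: (@le_trans _ _ (\sum_u' \sum_N weight1 u' * Num.min 1 (M2%:R * mass N u'))).
  apply: ler_sum => u' _; rewrite -mulr_sumr ler_wpM2l ?weight1_ge0 //.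
  rewrite [X in _ * X](partition_big (key u') xpredT) //= mulr_sumr.
  by apply: min1_subadditive => N; apply: mulr_ge0 => //; exact: mass_ge0.
rewrite exchange_big /= -sum1_card natr_sum mulr_suml; apply: ler_sum => N _.
rewrite mul1r.
have [[u0 v0] /= /andP[E0 /eqP N0]|none] :=
    pickP [pred w : U * V | E w.1 w.2 && (key w.1 w.2 == N)]; last first.
  rewrite big1 ?mulr_ge0 ?powR_ge0 // => u' _.
  rewrite /mass big_pred0 ?mulr0 ?min_r ?mulr0 // => v'.
  exact: (none (u', v')).
set f := ptype R (zip3 u0 v0 z).
have f01 t : 0 <= f t <= 1.
  rewrite ptype_ge0 /=; have [f0 <-] := ptype_dist R (zip3 u0 v0 z) n_gt0.
  by rewrite (bigD1 t) //= lerDl sumr_ge0.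
have cf : c < exponent1 f + posp (exponent2 f - R2).
  by apply: Hc => // i; apply: (defect_beats i de1 de2 ty E0).
(* The 2 comes from the bound on [M2]; when the positive part is 0, [B] is 2 and dominates the
   truncation value 1. *)
pose B : R := 2 * 2 `^ (- (n%:R * posp (exponent2 f - R2))).
have B0 : 0 <= B by rewrite mulr_ge0 ?powR_ge0.
have minB u' : Num.min 1 (M2%:R * mass N u') <=
    if same_type R (fun k => (u' k, z k)) (fun k => (u0 k, z k)) then B else 0.
  have [v1 /andP[E1 /eqP N1]|none] := pickP [pred v' | E u' v' && (key u' v' == N)];
    last first.
    rewrite /mass (big_pred0 _ _ _ _ none) mulr0 min_r //.
    by case: ifP.
  have ff : ptype R (zip3 u' v1 z) = f.
    by apply/funext/type_counts_ptype; rewrite -/(key u' v1) N1.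
  have -> : same_type R (fun k => (u' k, z k)) (fun k => (u0 k, z k)).
    apply/forallP => w; apply/eqP.
    rewrite (_ : (fun k => (u' k, z k)) = @rvX1Y X1 X2 Y \o zip3 u' v1 z) //.
    rewrite (_ : (fun k => (u0 k, z k)) = @rvX1Y X1 X2 Y \o zip3 u0 v0 z) //.
    by rewrite -!pmf_of_ptype ff.
  have massE : mass N u' <= 2 `^ (- (n%:R * exponent2 f)).
    rewrite -ff; apply: le_trans (satellite_class u' v1 z).
    rewrite /mass big_mkcond [leRHS]big_mkcond; apply: ler_sum => v' _.
    rewrite -N1; case: ifP => [/andP[_ ->]//|_].
    by case: ifP => // _; exact: weight2_ge0.
  rewrite /B /posp; have [le0|lt0] := leP (exponent2 f - R2) 0.
    by rewrite mulr0 oppr0 powRr0 mulr1 ge_min ler1n.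
  rewrite ge_min; apply/orP; right.
  apply: (@le_trans _ _ (2 * 2 `^ (n%:R * R2) * 2 `^ (- (n%:R * exponent2 f)))).
    by rewrite ler_pM.
  rewrite -mulrA -pow2D ler_pM2l //; apply: le_pow2.
  by rewrite (mulrBr _ (exponent2 f)) opprB.
apply: (@le_trans _ _ (\sum_(u' : U | same_type R (fun k => (u' k, z k)) (fun k => (u0 k, z k)))
    weight1 u' * B)).
  rewrite [leRHS]big_mkcond; apply: ler_sum => u' _.
  have := minB u'; case: ifP => _ le_min; last first.
    by rewrite -[leRHS](mulr0 (weight1 u')) ler_wpM2l ?weight1_ge0.
  by rewrite ler_wpM2l ?weight1_ge0.
rewrite -mulr_suml.
apply: (@le_trans _ _ (2 `^ (- (n%:R * exponent1 f)) * B)).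
  rewrite ler_wpM2r //; exact: (center_class u0 v0 z).
rewrite /B mulrCA -pow2D ler_wpM2l //; apply: le_pow2.
rewrite -opprD lerN2 -mulrDr.
by rewrite ler_wpM2l // ltW.
Qed.

(** Both rates are lowered by [eps] while the exponents lose only [eps / 2], so the rivals
    contribute 1 + 2 = 3 terms decaying like 2^(-n eps/2). A third [eps] pays for the halving by
    expurgation. *)
Lemma superposition_code (delta eta R1 R2 eps : R) :
  0 <= R2 -> 0 < eps -> 0 < delta ->
  #|{: T}|%:R * delta <= eta -> delta * \sum_t `|qtT qt t| <= eta ->
  (forall f, (forall t, 0 <= f t <= 1) ->
    (forall i, defect (@rvX1Y X1 X2 Y) i f <= eta) -> R2 - eps / 2 < exponent2 f) ->
  (forall f, (forall t, 0 <= f t <= 1) ->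
    (forall i, defect (@rvY X1 X2 Y) i f <= eta) ->
    R1 - eps / 2 < exponent1 f + posp (exponent2 f - R2)) ->
  let e := #|{: T}|%:R / (n%:R * delta ^+ 2) +
           3 * (#|{: types}|%:R * 2 `^ (- (n%:R * (eps / 2)))) in
  e <= 2^-1 -> 2 <= 2 `^ (n%:R * eps) ->
  exists M (c : 'I_M -> 'I_n -> X),
    2 `^ (n%:R * (R1 + R2 - 3 * eps)) <= M%:R :> R /\ avg_err W q c <= 2 * e.
Proof.
move=> R2_ge0 eps0 d0 de1 de2 H2 H1 e e2 eps2.
have nR : 0 < n%:R :> R by rewrite ltr0n.
(* One more than the integer part: the size is at least the power of 2, and the number of rivals,
   one less, is at most that power. *)
pose size_of (r : R) := (Num.trunc ((2 : R) `^ (n%:R * (r - eps)))).+1.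
have size_ge r : 2 `^ (n%:R * (r - eps)) <= (size_of r)%:R by rewrite ltW // truncnS_gt.
have size_pred r : (size_of r).-1%:R <= 2 `^ (n%:R * (r - eps)).
  by rewrite /size_of /= truncn_le powR_ge0.
(* The successor is absorbed by doubling, since 1 <= 2^(n R2) for nonnegative [R2]. *)
have size_le : (size_of R2)%:R <= 2 * 2 `^ (n%:R * R2).
  rewrite /size_of -addn1 natrD [leRHS]mulr_natl mulr2n lerD //.
    apply: le_trans (size_pred R2) _; apply: le_pow2.
    by rewrite ler_pM2l // gerBl ltW.
  by rewrite -[leLHS](powRr0 (2 : R)) le_pow2 // mulr_ge0.
pose K : R := #|{: types}|%:R.
pose a : R := K * 2 `^ (- (n%:R * (R2 - eps / 2))).
pose b : R := K * (2 * 2 `^ (- (n%:R * (R1 - eps / 2)))).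
have a0 : 0 <= a by rewrite mulr_ge0 ?powR_ge0.
have b0 : 0 <= b by rewrite !mulr_ge0 ?powR_ge0.
have [F HF] := @superposition_random_coding R U V Z (size_of R1) (size_of R2)
  weight1 weight2 block_channel block_metric (good_pair eta) (typical delta)
  weight1_ge0 sum_weight1 weight2_ge0 sum_weight2
  (fun u v z => chan_n_ge0 channelW (word u v) z) (fun u v => sum_chan_n channelW (word u v))
  a b _ (atypical_weight d0) (fun u v z => @typical_good delta eta u v z de1) a0 b0
  (fun u v z => same_cloud_bound de1 de2 H2)
  (fun u v z => other_cloud_bound de1 de2 H1 size_le).
have cI : #|{: 'I_(size_of R1) * 'I_(size_of R2)}|%:R = (size_of R1 * size_of R2)%:R :> R.
  by rewrite card_prod !card_ord.
have prod_pow r s : (2 : R) `^ (n%:R * (r - eps)) * 2 `^ (- (n%:R * (r - s))) =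
    2 `^ (- (n%:R * (eps - s))).
  by rewrite -pow2D; congr (_ `^ _); ring.
have half : eps - eps / 2 = eps / 2 by field.
have le_e : #|{: T}|%:R / (n%:R * delta ^+ 2) + (size_of R2).-1%:R * a +
    (size_of R1).-1%:R * b <= e.
  rewrite /e -addrA lerD2l.
  have ha : (size_of R2).-1%:R * a <= K * 2 `^ (- (n%:R * (eps / 2))).
    rewrite /a mulrCA ler_wpM2l // -{2}half -(prod_pow R2).
    by rewrite ler_wpM2r ?powR_ge0.
  have hb : (size_of R1).-1%:R * b <= 2 * (K * 2 `^ (- (n%:R * (eps / 2)))).
    rewrite /b mulrCA (mulrCA 2) ler_wpM2l // mulrCA ler_wpM2l // -{2}half -(prod_pow R1).
    by rewrite ler_wpM2r ?powR_ge0.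
  rewrite -/K; lra.
have le_F : \sum_m \sum_z block_channel (cloud_center F m) (satellite F m) z *
    (failure block_metric (good_pair eta) F m z)%:R <=
    #|{: 'I_(size_of R1) * 'I_(size_of R2)}|%:R * e.
  by apply: le_trans HF _; rewrite cI ler_wpM2l.
have [|M [c [M_ge c_err]]] := @expurgation R X Y W q channelW n _
  (fun m => word (cloud_center F m) (satellite F m))
  (fun m => good_pair eta (cloud_center F m) (satellite F m)) e le_F _ e2.
  by rewrite card_prod !card_ord.
exists M, c; split => //; apply: le_trans M_ge.
rewrite ler_pdivlMr // cI natrM.
apply: (@le_trans _ _ (2 `^ (n%:R * (R1 - eps)) * 2 `^ (n%:R * (R2 - eps)))); last first.
  by rewrite ler_pM ?powR_ge0.
apply: (@le_trans _ _ (2 `^ (n%:R * (R1 + R2 - 3 * eps)) * 2 `^ (n%:R * eps))).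
  by rewrite ler_wpM2l ?powR_ge0.
rewrite -!pow2D le_eqVlt; apply/orP; left; apply/eqP; congr (_ `^ _); ring.
Qed.

End Blocklength.

Lemma superposition_achievable (R1 R2 r : R) :
  0 <= R2 ->
  (forall f, L2set qt P f ->
    R2 <= cmutinf f (@rvX2 X1 X2 Y) (@rvY X1 X2 Y) (@rvX1 X1 X2 Y)) ->
  (forall f, L0set qt P f -> R1 <= mutinf f (@rvX1 X1 X2 Y) (@rvY X1 X2 Y) +
    posp (cmutinf f (@rvX2 X1 X2 Y) (@rvY X1 X2 Y) (@rvX1 X1 X2 Y) - R2)) ->
  r < R1 + R2 -> achievable W q r.
Proof.
move=> R2_ge0 H2 H1 rR; pose eps := (R1 + R2 - r) / 3.
have eps0 : 0 < eps by rewrite divr_gt0 // subr_gt0.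
have [eta2 eta2_gt0 He2] : exists2 eta, 0 < eta & forall f, (forall t, 0 <= f t <= 1) ->
    (forall i, defect (@rvX1Y X1 X2 Y) i f <= eta) -> R2 - eps / 2 < exponent2 f.
  by apply: (same_cloud_exponent H2); rewrite ltrBlDr ltrDl divr_gt0.
have [eta1 eta1_gt0 He1] : exists2 eta, 0 < eta & forall f, (forall t, 0 <= f t <= 1) ->
    (forall i, defect (@rvY X1 X2 Y) i f <= eta) ->
    R1 - eps / 2 < exponent1 f + posp (exponent2 f - R2).
  by apply: (other_cloud_exponent H1); rewrite ltrBlDr ltrDl divr_gt0.
pose eta := Num.min eta1 eta2.
have eta_gt0 : 0 < eta by rewrite lt_min eta1_gt0.
have eta_le1 : eta <= eta1 by rewrite ge_min lexx.
have eta_le2 : eta <= eta2 by rewrite ge_min lexx orbT.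
pose A : R := #|{: T}|%:R; pose B := \sum_t `|qtT qt t|.
have A0 : 0 <= A by [].
have B0 : 0 <= B by apply: sumr_ge0.
(* Small enough for both tolerances below; the 1 keeps the denominator positive. *)
pose delta := eta / (A + B + 1).
have den0 : 0 < A + B + 1 by rewrite ltr_wpDl // addr_ge0.
have d0 : 0 < delta by rewrite divr_gt0.
have de1 : A * delta <= eta.
  rewrite mulrCA -[leRHS]mulr1 ler_pM2l // ler_pdivrMr // mul1r.
  by rewrite -addrA lerDl addr_ge0.
have de2 : delta * B <= eta.
  rewrite /delta -mulrA -[leRHS]mulr1 ler_pM2l // mulrC ler_pdivrMr // mul1r.
  by rewrite [A + B]addrC -addrA lerDl addr_ge0.
have [C [C0 HC]] := poly_exp_bound #|{: T}| (divr_gt0 eps0 (ltr0Sn R 1)).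
pose D := A / delta ^+ 2 + 3 * C.
have D0 : 0 <= D by rewrite addr_ge0 ?mulr_ge0 ?invr_ge0 ?sqr_ge0.
pose err (n : nat) := #|{: T}|%:R / (n%:R * delta ^+ 2) +
  3 * (#|{: {ffun T -> 'I_n.+1}}|%:R * 2 `^ (- (n%:R * (eps / 2)))) : R.
have err_le n : (0 < n)%N -> err n <= D / n%:R.
  move=> n0; rewrite /err /D [leRHS]mulrDl lerD //.
    by rewrite le_eqVlt; apply/orP; left; apply/eqP; rewrite invfM mulrCA mulrC mulrAC.
  rewrite -[leRHS]mulrA ler_wpM2l // card_ffun card_ord natrX.
  exact: HC.
have x0 : inhabited X.
  have [w0 _|no] := pickP (fun _ : X1 * X2 => true).
    by constructor; exact: (phi w0.1 w0.2).
  by have := distPX.2; rewrite big_pred0 // => /eqP; rewrite eq_sym oner_eq0.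
(* The error is at most 2D/n, and [harmonic n] is 1/(n+1); the extra factor 2 comes from n+1 <=
   2n. *)
apply: (achievable_cvg channelW (e := fun n => 4 * D * harmonic n)) => //.
  rewrite -[X in _ --> X](mulr0 (4 * D)); apply: cvgM; first exact: cvg_cst.
  exact: cvg_harmonic.
have near_big (c : R) : \forall n \near \oo, c <= n%:R.
  exact: nbhs_infty_ger.
near=> n.
have n0 : (0 < n)%N by near: n; exact: nbhs_infty_gt.
have nR : 0 < n%:R :> R by rewrite ltr0n.
have e2 : err n <= 2^-1.
  apply: le_trans (err_le _ n0) _; rewrite ler_pdivrMr // mulrC ler_pdivlMr //.
  by near: n; exact: near_big.
have eps2 : 2 <= 2 `^ (n%:R * eps) :> R.
  rewrite -[leLHS](@powRr1 R 2) // le_pow2 // -ler_pdivrMr //.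
  by near: n; exact: near_big.
have [M [c [M_ge c_err]]] := superposition_code n0 R2_ge0 eps0 d0 de1 de2
  (fun f f01 df => He2 f f01 (fun i => le_trans (df i) eta_le2))
  (fun f f01 df => He1 f f01 (fun i => le_trans (df i) eta_le1)) e2 eps2.
exists M, c; split.
  by rewrite (_ : r = R1 + R2 - 3 * eps) // /eps; field.
apply: le_trans c_err _; apply: (@le_trans _ _ (2 * (D / n%:R))).
  by rewrite ler_wpM2l // err_le.
rewrite (_ : 4 * D * harmonic n = 2 * D * (2 / n.+1%:R)); last by rewrite /harmonic /=; ring.
rewrite mulrA ler_wpM2l ?mulr_ge0 // ler_pdivlMr // mulrC ler_pdivrMr //.
by rewrite -natrM ler_nat mul2n -addnn -addn1 leq_add2l.
Unshelve. all: by end_near. Qed.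

End Superposition.

(** * The two rate regions *)

Section ChainRule.
Variables (R : realType) (T U V K : finType).
Variables (f : T -> R) (A : T -> U) (B : T -> V) (C : T -> K).

Lemma mutinf_chain : mutinf f A (pairRV B C) = cmutinf f A B C + mutinf f A C.
Proof.
rewrite /mutinf /cmutinf (@entropy_eqker _ _ _ _ f (pairRV A (pairRV B C))
  (pairRV (pairRV A B) C)); first by ring.
by move=> t t'; rewrite !xpair_eqE andbA.
Qed.

Lemma mutinf_sym : mutinf f A B = mutinf f B A.
Proof.
rewrite /mutinf (@entropy_eqker _ _ _ _ f (pairRV A B) (pairRV B A)); first by ring.
by move=> t t'; rewrite !xpair_eqE andbC.
Qed.

End ChainRule.

Lemma pmf_of_relabel (R : realType) (T U V : finType) (f : T -> R) (g : T -> U)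
    (h : T -> V) u v :
  (forall t, (g t == u) = (h t == v)) -> pmf_of f g u = pmf_of f h v.
Proof. by move=> gh; apply: eq_bigl. Qed.

Lemma pmf_of_comp_bij (R : realType) (T T' U : finType) (f : T -> R) (g : T -> U)
    (s : T' -> T) u :
  bijective s -> pmf_of (f \o s) (g \o s) u = pmf_of f g u.
Proof. by move=> bs; rewrite /pmf_of [RHS](reindex s) //; exact: onW_bij. Qed.

(** Makes I(X1;X2) a constant over the feasible sets, whose members all have the input marginal of
    [P]. *)
Lemma mutinf_X1X2 (R : realType) (X1 X2 Y : finType) (f P : (X1 * X2) * Y -> R) :
  same_marg (@rvX1X2 X1 X2 Y) f P ->
  mutinf f (@rvX1 X1 X2 Y) (@rvX2 X1 X2 Y) = mutinf P (@rvX1 X1 X2 Y) (@rvX2 X1 X2 Y).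
Proof.
move=> fP; have comp (U : finType) (h : X1 * X2 -> U) :
    entropy f (h \o @rvX1X2 X1 X2 Y) = entropy P (h \o @rvX1X2 X1 X2 Y).
  apply: eq_entropy => u.
  have split_pmf g : pmf_of g (h \o @rvX1X2 X1 X2 Y) u =
      \sum_(x | h x == u) pmf_of g (@rvX1X2 X1 X2 Y) x.
    rewrite /pmf_of (partition_big (@rvX1X2 X1 X2 Y) (fun x => h x == u)) //=.
    apply: eq_bigr => x /eqP hx; apply: eq_bigl => t; apply: andb_idl.
    by move=> /eqP ->; rewrite hx.
  by rewrite !split_pmf; apply: eq_bigr.
congr (_ + _ - _); first exact: (comp _ fst); first exact: (comp _ snd).
exact: (comp _ (fun x => (x.1, x.2))).
Qed.

(** * Exchanging the two input variables *)

Section Swap.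
Variables (R : realType) (X Y X1 X2 : finType) (W : X -> Y -> R) (q : X -> Y -> R).
Variables (PX : X1 -> X2 -> R) (phi : X1 -> X2 -> X).

Local Notation T := ((X1 * X2) * Y)%type.
Local Notation T' := ((X2 * X1) * Y)%type.
Local Notation P := (joint_P PX W phi).
Local Notation P' := (joint_P (fun x2 x1 => PX x1 x2) W (fun x2 x1 => phi x1 x2)).
Local Notation qt := (induced_metric q phi).
Local Notation qt' := (induced_metric q (fun x2 x1 => phi x1 x2)).

Definition swapX (t : T) : T' := ((t.1.2, t.1.1), t.2).

Lemma swapX_bij : bijective swapX.
Proof. by exists (fun t => ((t.1.2, t.1.1), t.2)) => -[[]]. Qed.

Lemma Gset_swap f : Gset qt' P' f -> Gset qt P (f \o swapX).
Proof.
have sum_swap (g : T' -> R) : \sum_t g (swapX t) = \sum_t g t.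
  by rewrite [RHS](reindex swapX) //; apply: onW_bij; exact: swapX_bij.
move=> [[f0 f1] [fP fq]]; split; first by split=> [t|]; [exact: f0|rewrite -f1 -sum_swap].
split; last first.
  have -> : expect P (qtT qt) = expect P' (qtT qt') by rewrite /expect -sum_swap.
  have -> : expect (f \o swapX) (qtT qt) = expect f (qtT qt').
    by rewrite /expect -[RHS]sum_swap.
  exact: fq.
move=> [x1 x2].
have relabel (g : T' -> R) : pmf_of (g \o swapX) (@rvX1X2 X1 X2 Y) (x1, x2) =
    pmf_of g (@rvX1X2 X2 X1 Y) (x2, x1).
  rewrite -(pmf_of_comp_bij _ (@rvX1X2 X2 X1 Y) _ swapX_bij).
  by apply: pmf_of_relabel => -[[a b] y]; rewrite /= /rvX1X2 /swapX /= !xpair_eqE andbC.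
by rewrite relabel fP -relabel.
Qed.

(** After the exchange the cloud variable is [X2], so the constraint of [L2set] on cloud and output
    becomes that of [L1set]. *)
Lemma L1set_swap f : L2set qt' P' f -> L1set qt P (f \o swapX).
Proof.
move=> [fG fm]; split; first exact: Gset_swap.
move=> u; have := fm u.
by rewrite -(pmf_of_comp_bij f _ u swapX_bij) -(pmf_of_comp_bij P' _ u swapX_bij).
Qed.

Lemma L0set_swap f : L0set qt' P' f -> L0set qt P (f \o swapX).
Proof.
move=> [fG fm]; split; first exact: Gset_swap.
move=> u; have := fm u.
by rewrite -(pmf_of_comp_bij f _ u swapX_bij) -(pmf_of_comp_bij P' _ u swapX_bij).
Qed.

Lemma cmutinf_swap (f : T' -> R) :
  cmutinf (f \o swapX) (@rvX1 X1 X2 Y) (@rvY X1 X2 Y) (@rvX2 X1 X2 Y) =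
  cmutinf f (@rvX2 X2 X1 Y) (@rvY X2 X1 Y) (@rvX1 X2 X1 Y).
Proof. by rewrite /cmutinf -!(entropy_comp_bij f _ swapX_bij). Qed.

Lemma mutinf_swap (f : T' -> R) :
  mutinf (f \o swapX) (@rvX2 X1 X2 Y) (@rvY X1 X2 Y) =
  mutinf f (@rvX1 X2 X1 Y) (@rvY X2 X1 Y).
Proof. by rewrite /mutinf -!(entropy_comp_bij f _ swapX_bij). Qed.

End Swap.

Lemma is_dist_swap (R : realType) (X1 X2 : finType) (PX : X1 -> X2 -> R) :
  is_dist (fun x : X1 * X2 => PX x.1 x.2) -> is_dist (fun x : X2 * X1 => PX x.2 x.1).
Proof.
move=> [P0 P1]; split=> [x|]; first exact: (P0 (x.2, x.1)).
rewrite -P1 -(pair_bigA _ (fun b a => PX a b)) -(pair_bigA _ (fun a b => PX a b)) /=.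
exact: exchange_big.
Qed.

Section RateRegion.
Variables (R : realType) (X1 X2 Y : finType) (qt : X1 -> X2 -> Y -> R).
Variable P : (X1 * X2) * Y -> R.

Lemma posp_ge0 (x : R) : 0 <= posp x. Proof. by rewrite le_max lexx. Qed.

(** An [inf] of reals is a lower bound only when the set is bounded below; nonnegativity of
    information supplies this here and in the next two lemmas. *)
Lemma R1p_le f : L1set qt P f -> R1p qt P <= mutinf f (@rvX1 X1 X2 Y) (@rvYX2 X1 X2 Y).
Proof.
move=> Lf; apply: ge_inf; last by exists f.
by exists 0 => _ [g [[gd _] _] <-]; exact: mutinf_ge0.
Qed.

Lemma R2p_le f : L2set qt P f ->
  R2p qt P <= cmutinf f (@rvX2 X1 X2 Y) (@rvY X1 X2 Y) (@rvX1 X1 X2 Y).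
Proof.
move=> Lf; apply: ge_inf; last by exists f.
by exists 0 => _ [g [[gd _] _] <-]; exact: cmutinf_ge0.
Qed.

Lemma R1pp_le R2 f : L0set qt P f ->
  R1pp qt P R2 <= mutinf f (@rvX1 X1 X2 Y) (@rvY X1 X2 Y) +
    posp (cmutinf f (@rvX2 X1 X2 Y) (@rvY X1 X2 Y) (@rvX1 X1 X2 Y) - R2).
Proof.
move=> Lf; apply: ge_inf; last by exists f.
by exists 0 => _ [g [[gd _] _] <-]; rewrite addr_ge0 ?posp_ge0 // mutinf_ge0.
Qed.

(** The difference of informations may be negative; I(X1;X2) is constant on [L0set], and its
    opposite is a lower bound. *)
Lemma R2pp_le R1 f : L0set qt P f ->
  R2pp qt P R1 <= mutinf f (@rvX2 X1 X2 Y) (@rvY X1 X2 Y)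
    - mutinf f (@rvX2 X1 X2 Y) (@rvX1 X1 X2 Y)
    + posp (mutinf f (@rvX1 X1 X2 Y) (@rvYX2 X1 X2 Y) - R1).
Proof.
move=> Lf; apply: ge_inf; last by exists f.
exists (- mutinf P (@rvX1 X1 X2 Y) (@rvX2 X1 X2 Y)) => _ [g [[gd [gP _]] _] <-].
rewrite (mutinf_sym g (@rvX2 X1 X2 Y) (@rvX1 X1 X2 Y)) (mutinf_X1X2 gP).
by rewrite addrAC lerDr addr_ge0 ?posp_ge0 // mutinf_ge0.
Qed.

End RateRegion.

Section Regions.
Variables (R : realType) (X Y X1 X2 : finType) (W : X -> Y -> R) (q : X -> Y -> R).
Variables (PX : X1 -> X2 -> R) (phi : X1 -> X2 -> X).
Hypothesis channelW : is_channel W.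
Hypothesis distPX : is_dist (fun x : X1 * X2 => PX x.1 x.2).
Local Notation P := (joint_P PX W phi).
Local Notation qt := (induced_metric q phi).

Lemma Rsup_cog_achievable (R1 R2 r : R) :
  Rsup_cog qt P (R1, R2) -> r < R1 + R2 -> achievable W q r.
Proof.
move=> [/= _ [R2_ge0 [R2_le R1_le]]] rR.
apply: (superposition_achievable (phi := phi) channelW distPX R2_ge0 _ _ rR) => f Lf.
  exact: le_trans R2_le (R2p_le Lf).
exact: le_trans R1_le (R1pp_le _ Lf).
Qed.

(* Superposition with [X2] as the cloud variable: the binning rate [Ra] exceeds
   the rate of the satellites by the binning overhead I(X1;X2), which is carried
   by the cloud centers; if [Ra] is smaller than I(X1;X2), there is a single
   satellite per cloud. *)
Lemma binning_achievable (Ra Rb r : R) :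
  Ra <= R1p qt P -> Rb <= R2pp qt P Ra ->
  r < Ra + Rb -> achievable W q r.
Proof.
move=> Ra_le Rb_le rR.
have Pd : is_dist P by exact: joint_P_dist.
pose I := mutinf P (@rvX1 X1 X2 Y) (@rvX2 X1 X2 Y).
have I0 : 0 <= I by exact: mutinf_ge0.
have rate1 f : L1set qt P f ->
    Ra - I <= cmutinf f (@rvX1 X1 X2 Y) (@rvY X1 X2 Y) (@rvX2 X1 X2 Y).
  move=> Lf; have := le_trans Ra_le (R1p_le Lf).
  (* Chain rule I(X1;Y,X2) = I(X1;Y|X2) + I(X1;X2), whose last term is [I]. *)
  rewrite (mutinf_chain f (@rvX1 X1 X2 Y) (@rvY X1 X2 Y) (@rvX2 X1 X2 Y)).
  by rewrite (mutinf_X1X2 Lf.1.2.1) -/I lerBlDr.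
have rate2 f : L0set qt P f -> Rb <= mutinf f (@rvX2 X1 X2 Y) (@rvY X1 X2 Y) - I +
    posp (cmutinf f (@rvX1 X1 X2 Y) (@rvY X1 X2 Y) (@rvX2 X1 X2 Y) + I - Ra).
  move=> Lf; have := le_trans Rb_le (R2pp_le _ Lf).
  rewrite (mutinf_chain f (@rvX1 X1 X2 Y) (@rvY X1 X2 Y) (@rvX2 X1 X2 Y)).
  rewrite (mutinf_sym f (@rvX2 X1 X2 Y) (@rvX1 X1 X2 Y)).
  by rewrite (mutinf_X1X2 Lf.1.2.1).
pose B := Num.max 0 (Ra - I).
have B0 : 0 <= B by rewrite le_max lexx.
apply: (superposition_achievable (PX := fun x2 x1 => PX x1 x2)
  (phi := fun x2 x1 => phi x1 x2) (R1 := Ra + Rb - B)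
  channelW (is_dist_swap distPX) B0) => [f Lf|f Lf|].
- rewrite -cmutinf_swap; have Lf' := L1set_swap Lf.
  have := rate1 _ Lf'; have := cmutinf_ge0 (@rvX1 X1 X2 Y) (@rvY X1 X2 Y) (@rvX2 X1 X2 Y) Lf'.1.1.
  by rewrite /B ge_max => -> ->.
- rewrite -cmutinf_swap -mutinf_swap; have Lf' := L0set_swap Lf.
  have := rate2 _ Lf'; have := cmutinf_ge0 (@rvX1 X1 X2 Y) (@rvY X1 X2 Y) (@rvX2 X1 X2 Y) Lf'.1.1.
  set c := cmutinf _ _ _ _; set m := mutinf _ _ _; rewrite /B /posp => c0.
  (* If [Ra] exceeds [I], the cloud rate is [Rb + I] and [rate2] is the claim. Otherwise [B] is 0,
     both positive parts are their arguments as [c] is nonnegative, and [I] cancels. *)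
  by have [h|h] := leP (Ra - I) 0; have [h2|h2] := leP (c + I - Ra) 0;
     have [h3|h3] := leP (c - _) 0; lra.
by rewrite subrK.
Qed.

Lemma Rbin_cog_achievable (R1 R2 r : R) :
  Rbin_cog qt P (R1, R2) -> r < R1 + R2 -> achievable W q r.
Proof.
move=> [/= R1_ge0 [R2_ge0 [Ra [Rb [Ra0 [Rb0 [-> [Ra_le [Rb_le +]]]]]]]]].
(* The part [Rb] of the first rate is regrouped with [R2], which leaves the sum rate unchanged. *)
rewrite -addrA => -[Ra_le'|Rb_le']; last first.
  exact: binning_achievable.
by apply: Rsup_cog_achievable; split => //=; split; rewrite ?addr_ge0.
Qed.

End Regions.

Lemma le_mismatch_capacity (R : realType) (X Y : finType) (W q : X -> Y -> R) (s : R) :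
  (forall r, r < s -> achievable W q r) -> (s%:E <= mismatch_capacity W q)%E.
Proof.
move=> H; apply/lee_subgt0Pr => e e0; rewrite -EFinB.
apply: ereal_sup_ubound; exists (s - e) => //; apply: H.
by rewrite ltrBlDr ltrDl.
Qed.

Theorem theorem7 (R : realType) (X Y : finType) (W : X -> Y -> R)
    (q : X -> Y -> R) (X1 X2 : finType) (PX : X1 -> X2 -> R)
    (phi : X1 -> X2 -> X) :
  is_channel W ->
  is_dist (fun x : (X1 * X2)%type => PX x.1 x.2) ->
  (ereal_sup [set (r.1 + r.2)%:E
     | r in R_cog (induced_metric q phi) (joint_P PX W phi)]
   <= mismatch_capacity W q)%E.
Proof.
move=> channelW distPX; apply: ge_ereal_sup => _ [[R1 R2] Rcog <-] /=.
apply: le_mismatch_capacity => r rR; case: Rcog => H.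
  exact: (Rsup_cog_achievable channelW distPX H).
exact: (Rbin_cog_achievable channelW distPX H).
Qed.
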